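(* Let $N\ge 2$, let $\Omega\subset\mathbb{R}^{N}$ be a bounded open set containing the origin, let $\widetilde{R}=\sup_{x\in\Omega}|x|$ and let $R>\widetilde{R}$. Then there exists a constant $C=C(N,R,\widetilde{R})>0$ (depending only on $N,R,\widetilde{R}$) such that $$\int_{\Omega}|\nabla u(x)|^{N}\,dx-\left(\frac{N-1}{N}\right)^{N}\int_{\Omega}\frac{|u(x)|^{N}}{|x|^{N}\left(\log\frac{R}{|x|}\right)^{N}}\,dx\;\ge\;\|u\|_{\operatorname{Exp}L^{\frac{N}{N-1}}(\Omega)}^{N}\,\bigl(\mathcal{D}_{N,R,C}(u)\bigr)^{N}$$ for every $u\in W^{1,N}_{0}(\Omega)$, where the right-hand side is understood to be $0$ when $u=0$ a.e.
   Context: Functions are real-valued. $W^{1,N}_{0}(\Omega)$ is the completion of $C_c^\infty(\Omega)$ with respect to the $W^{1,N}(\Omega)$ norm. Luxemburg norm: with $\Phi(t)=\exp\bigl(t^{\frac{N}{N-1}}\bigr)-1$ for $t\ge 0$, the Orlicz space $\operatorname{Exp}L^{\frac{N}{N-1}}(\Omega)$ consists of the measurable $u:\Omega\to\mathbb{R}$ with $\int_\Omega\Phi(|u(x)|/\lambda)\,dx<\infty$ for some $\lambda>0$, and $$\|u\|_{\operatorname{Exp}L^{\frac{N}{N-1}}(\Omega)}=\inf\Bigl\{\lambda>0:\int_\Omega\Phi\Bigl(\frac{|u(x)|}{\lambda}\Bigr)dx\le 1\Bigr\}.$$ Virtual extremizer: $\omega_{R}(x)=\left(\log\frac{R}{|x|}\right)^{\frac{N-1}{N}}$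 for $x\in\Omega\setminus\{0\}$. Distance function: for $C>0$ and $u$ not a.e. zero, $$\mathcal{D}_{N,R,C}(u)=\inf_{a\in\mathbb{R}}\int_{\Omega}\left[\exp\left(\frac{C\,|u(x)-a\,\omega_{R}(x)|^{\frac{N}{N-1}}}{\|u\|^{\frac{N}{N-1}}_{\operatorname{Exp}L^{\frac{N}{N-1}}(\Omega)}}\right)-1\right]dx.$$ *)

(* Defs.v *)
From HB Require Import structures.
From mathcomp Require Import all_boot all_order all_algebra.
From mathcomp Require Import all_classical all_reals all_analysis.

Set Implicit Arguments.
Unset Strict Implicit.
Unset Printing Implicit Defensive.

Import Order.TTheory GRing.Theory Num.Theory.
Import numFieldNormedType.Exports.

Local Open Scope classical_set_scope.
Local Open Scope ring_scope.

(* 'rV[R]_n carries the sigma-algebra generated by the coordinates, that is, its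
   Borel sigma-algebra. *)
Definition rV_display : measure_display. Proof. exact: default_measure_display. Qed.

Section measurable_rV.
Variables (R : realType) (n : nat).

Definition rV_coord (i : 'I_n) (x : 'rV[R]_n) : measurableTypeR R := x ord0 i.

Let rV_set0 : g_sigma_preimage rV_coord set0.
Proof. exact: sigma_algebra0. Qed.

Let rV_setC A : g_sigma_preimage rV_coord A -> g_sigma_preimage rV_coord (~` A).
Proof. exact: sigma_algebraC. Qed.

Let rV_bigcup (F : _^nat) : (forall i, g_sigma_preimage rV_coord (F i)) ->
  g_sigma_preimage rV_coord (\bigcup_i (F i)).
Proof. exact: sigma_algebra_bigcup. Qed.

HB.instance Definition _ := @isMeasurable.Build rV_display
  'rV[R]_n (g_sigma_preimage rV_coord) rV_set0 rV_setC rV_bigcup.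

End measurable_rV.


Section lebesgue_rV.
Variable R : realType.

Definition cons_rV n (p : measurableTypeR R * 'rV[R]_n) : 'rV[R]_n.+1 :=
  \row_i oapp (p.2 ord0) p.1 (unlift ord0 i).

Lemma measurable_rV_coord n (i : 'I_n) : measurable_fun setT (@rV_coord R n i).
Proof.
move=> _ Y mY; rewrite setTI; apply: sub_sigma_algebra => /=.
rewrite -bigcup_seq/=; exists i => /=; first by rewrite mem_index_enum.
by exists Y => //; rewrite setTI.
Qed.

Lemma measurable_fun_rVP d (T : measurableType d) n (f : T -> 'rV[R]_n) :
  measurable_fun setT f <-> forall i, measurable_fun setT (rV_coord i \o f).
Proof.
split=> [mf i|mf].
  exact: measurableT_comp (measurable_rV_coord i) mf.
suff : g_sigma_preimage (fun i => @rV_coord R n i \o f) `<=` measurable.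
  rewrite g_sigma_preimage_comp => prefS.
  by move=> _ A mA; apply: prefS; exists A.
apply: smallest_sub; first exact: sigma_algebra_measurable.
case: n => [|n] in f mf *; first by rewrite big_ord0.
rewrite -bigcup_mkord_ord; apply: bigcup_sub => i Ii.
by move=> A [B mB <-]; exact: mf.
Qed.

Lemma measurable_cons_rV n : measurable_fun setT (@cons_rV n).
Proof.
apply/measurable_fun_rVP => i.
case: (unliftP ord0 i) => [j ij|i0].
  rewrite (_ : _ \o _ = @rV_coord R n j \o snd).
    by apply: measurableT_comp => //; exact: measurable_rV_coord.
  by apply/funext => p; rewrite /rV_coord/= mxE ij liftK.
rewrite (_ : _ \o _ = fst) //.
by apply/funext => p; rewrite /rV_coord/= mxE i0 unlift_none.
Qed.

Definition uncons_rV n (x : 'rV[R]_n.+1) : measurableTypeR R * 'rV[R]_n :=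
  (x ord0 ord0, \row_i x ord0 (lift ord0 i)).

Lemma cons_rVK n : cancel (@cons_rV n) (@uncons_rV n).
Proof.
move=> [a y]; congr (_, _) => /=; first by rewrite mxE unlift_none.
by apply/rowP => i; rewrite !mxE liftK.
Qed.

Lemma measurable_uncons_rV n : measurable_fun setT (@uncons_rV n).
Proof.
apply/measurable_fun_pair; first exact: measurable_rV_coord.
apply/measurable_fun_rVP => i.
rewrite (_ : _ \o _ = @rV_coord R n.+1 (lift ord0 i)).
  exact: measurable_rV_coord.
by apply/funext => x; rewrite /rV_coord/= mxE.
Qed.

Section step.
Variables (n : nat) (m : {sigma_finite_measure set 'rV[R]_n -> \bar R}).

Definition lebesgue_step : set 'rV[R]_n.+1 -> \bar R :=
  pushforward (lebesgue_measure \x m)%E (@cons_rV n).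

HB.instance Definition _ := Measure.copy lebesgue_step
  (measure_function_pushforward__canonical__measure_function_Measure
     (lebesgue_measure \x m)%E (@measurable_cons_rV n)).

Let lebesgue_step_sigma_finite : sigma_finite setT lebesgue_step.
Proof.
have /sigma_finiteP[F [TF ndF Foo]] := sigma_finiteT (@lebesgue_measure R).
have /sigma_finiteP[G [TG ndG Goo]] := sigma_finiteT m.
exists (fun k => @uncons_rV n @^-1` (F k `*` G k)).
  rewrite -preimage_bigcup (_ : \bigcup_k _ = setT) ?preimage_setT//.
  rewrite -subTset => -[x y] _.
  have [i _ Fix] : (\bigcup_k F k) x by rewrite -TF.
  have [j _ Gjy] : (\bigcup_k G k) y by rewrite -TG.
  exists (maxn i j) => //; split.
    by move: x Fix; exact/subsetPset/ndF/leq_maxl.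
  by move: y Gjy; exact/subsetPset/ndG/leq_maxr.
move=> k; have [mF Fk] := Foo k; have [mG Gk] := Goo k; split.
  rewrite -[X in measurable X]setTI; apply: measurable_uncons_rV => //.
  exact: measurableX.
rewrite /lebesgue_step /pushforward -comp_preimage.
rewrite (_ : _ \o _ = id) ?preimage_id.
  by rewrite product_measure1E// lte_mul_pinfty// ge0_fin_numE.
by apply/funext => p; exact: cons_rVK.
Qed.

HB.instance Definition _ := Measure_isSigmaFinite.Build _ _ _ lebesgue_step
  lebesgue_step_sigma_finite.

End step.

(* Borel restriction of the n-dimensional Lebesgue measure: the n-fold product
   of the one-dimensional one. *)
Fixpoint lebesgue_rV n : {sigma_finite_measure set 'rV[R]_n -> \bar R} :=
  if n is n'.+1 then lebesgue_step (lebesgue_rV n') else \d_(0 : 'rV[R]_0).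

Lemma lebesgue_rV_box n (A : 'I_n -> set (measurableTypeR R)) :
  (forall i, measurable (A i)) ->
  lebesgue_rV n [set x | forall i, A i (x ord0 i)] =
  (\prod_(i < n) lebesgue_measure (A i))%E.
Proof.
elim: n => [|n IH] in A * => mA.
  by rewrite big_ord0 /= diracE mem_set// => -[].
rewrite big_ord_recl -IH//= /lebesgue_step /pushforward.
rewrite -product_measure1E//; last first.
  suff -> : (fun y : 'rV[R]_n => forall i, A (lift ord0 i) (y ord0 i)) =
      \bigcap_(i in [set: 'I_n]) (@rV_coord R n i @^-1` A (lift ord0 i)).
    apply: fin_bigcap_measurable => // i _.
    by rewrite -[X in measurable X]setTI; exact: measurable_rV_coord.
  by apply/seteqP; split => y /= Ay i; [move=> _|]; exact: Ay.
congr (product_measure1 _ _ _); apply/seteqP; split => [[a y]/= Ay|[a y]/= [Aa Ay] i].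
  split; first by have := Ay ord0; rewrite mxE unlift_none.
  by move=> i; have := Ay (lift ord0 i); rewrite mxE liftK.
by rewrite mxE; case: (unliftP ord0 i) => [j ->|->]/=; [exact: Ay|].
Qed.

End lebesgue_rV.

Section calculus.
Variables (R : realType) (n : nat).
Implicit Types (x : 'rV[R]_n) (f u : 'rV[R]_n -> R) (g : 'rV[R]_n -> 'rV[R]_n).
Implicit Types Omega : set 'rV[R]_n.

(* The library norm of 'rV[R]_n is the max norm; |x| in the mathematics below is
   the Euclidean norm. *)
Definition enorm x : R := Num.sqrt (\sum_(i < n) x ord0 i ^+ 2).

Definition partial (i : 'I_n) f : 'rV[R]_n -> R :=
  fun x => 'D_(delta_mx ord0 i) f x.

Definition gradient f : 'rV[R]_n -> 'rV[R]_n := fun x => \row_i partial i f x.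

(* All iterated partial derivatives exist and are continuous. *)
Definition smooth f : Prop := forall s : seq 'I_n,
  continuous (foldr partial f s) /\
  forall i x, derivable (foldr partial f s) x (delta_mx ord0 i).

Definition test_function Omega f : Prop :=
  let supp := closure [set x | f x != 0] in
  [/\ smooth f, compact supp & supp `<=` Omega].

Definition sobolev_norm (p : nat) Omega u g : \bar R :=
  ((\int[lebesgue_rV R n]_(x in Omega) (`|u x| ^+ p)%:E +
    \int[lebesgue_rV R n]_(x in Omega) (enorm (g x) ^+ p)%:E) `^ p%:R^-1)%E.

(* u belongs to W^{1,p}_0(Omega) and has gradient g. The completion of
   C_c^oo(Omega) for the W^{1,p} norm is realized in L^p x (L^p)^n, as the set of
   limits (u, g) of pairs (phi, gradient phi); g is the value at u of the
   gradient extended by continuity, and it is unique up to null sets. *)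
Definition sobolev0 (p : nat) Omega u g : Prop :=
  [/\ measurable_fun Omega u, measurable_fun Omega g &
      exists phi : nat -> 'rV[R]_n -> R,
        (forall k, test_function Omega (phi k)) /\
        sobolev_norm p Omega (fun x => phi k x - u x)
          (fun x => gradient (phi k) x - g x) @[k --> \oo] --> 0%E].

End calculus.

Section exponential_orlicz.
Variables (R : realType) (N : nat).
Implicit Types (x : 'rV[R]_N) (u : 'rV[R]_N -> R) (Omega : set 'rV[R]_N).

Definition conj_exponent : R := N%:R / (N%:R - 1).

Definition young (t : R) : R := expR (t `^ conj_exponent) - 1.

(* The infimum is taken in \bar R, so that the value is +oo exactly when u is not
   in Exp L^{N/(N-1)}(Omega). *)
Definition luxemburg Omega u : \bar R :=
  ereal_inf [set l%:E | l in [set l : R | 0 < l /\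
    (\int[lebesgue_rV R N]_(x in Omega) (young (`|u x| / l))%:E <= 1)%E]].

Definition virtual_extremizer (rho : R) x : R :=
  ln (rho / enorm x) `^ ((N%:R - 1) / N%:R).

(* Meaningful when 0 < luxemburg Omega u < +oo. *)
Definition extremizer_distance (rho C : R) Omega u : \bar R :=
  ereal_inf [set (\int[lebesgue_rV R N]_(x in Omega)
    (expR (C * `|u x - a * virtual_extremizer rho x| `^ conj_exponent /
           fine (luxemburg Omega u) `^ conj_exponent) - 1)%:E)%E
    | a in [set: R]].

End exponential_orlicz.

(* Main.v *)
Require Import Defs.
From mathcomp Require Import all_boot all_order all_algebra.
From mathcomp Require Import all_classical all_reals all_analysis measurable_realfun.
From mathcomp Require Import ring lra.

Set Implicit Arguments.
Unset Strict Implicit.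
Unset Printing Implicit Defensive.

Import Order.TTheory GRing.Theory Num.Theory.
Import numFieldNormedType.Exports.

Local Open Scope classical_set_scope.
Local Open Scope ring_scope.

(** The stability estimate follows from a Hardy inequality with a zero-order
    remainder. Write r = |x|, t = ln (R / r) and let kappa = ((N-1)/N)^N. Since
    r <= Rt < R on Omega, t stays away from 0, and functions vanishing on the
    boundary of Omega satisfy, for some c > 0 depending on N, R, Rt only,

      int |grad u|^N >= kappa int |u|^N / (r t)^N + c int |u|^N.

    The virtual extremizer does not vanish on the boundary, which is why the
    deficit controls u itself, and the competitor a = 0 is good enough in the
    definition of the distance.

    The Hardy inequality is proved by the vector-field method. For a field F, the
    divergence theorem applied to |u|^N F together with Young's inequality gives
    int |grad u|^N >= int (div F - (N-1) |F|^(N/(N-1))) |u|^N. With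
    F = (q / t)^(N-1) x / r^N and q constant equal to (N-1)/N, the bracket is
    exactly kappa / (r t)^N. Taking q = (N-1)/N + b r instead, with b small, leaves
    the maximum of (N-1) (q^(N-1) - q^N) by a second-order amount and gains a
    first-order term that exceeds c (r t)^N: this is [radial_ineq]. A
    nondecreasing cutoff in r removes the singularity of F at the origin with an
    error of the right sign ([div_profile_ge]). The inequality holds for test
    functions ([hardy_test_function]) with the cutoff still present; it then passes to
    the Sobolev space, where the cut-off weight is bounded, and finally the cutoff is
    removed by monotone convergence ([hardy_sobolev0]).

    For the right-hand side, put L = luxemburg Omega u. By convexity of the
    exponential, exp (C s) - 1 is at most a small multiple of
    exp (s / 2) - 1, which for s = (|u| / L)^(N/(N-1)) is at most
    (|u| / L) exp (s / 2). By Young's inequality the integral of this product is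
    bounded by the L^N norm of u / L times a constant depending on the volume of
    Omega, since the integral of exp s is controlled by the definition of L
    ([extremizer_distance_le]). Hence L times the distance is at most a small
    constant times the L^N norm of u, and its N-th power is at most c int |u|^N
    when C is small. *)

(** * Young's inequality with its defect *)

Section algebra.
Variable K : realType.
Implicit Types q b c s x y z : K.

(** The defect of Young's inequality n.+1 b q^n <= n q^n.+1 + b^n.+1, whose
    equality case is q = b. *)
Definition young_defect n q b : K :=
  n%:R * q ^+ n.+1 - n.+1%:R * b * q ^+ n + b ^+ n.+1.

(** The recursion exhibits the defect as (q - b)^2 times a polynomial with
    nonnegative coefficients; both Young's inequality and the quadratic upper
    bound on the defect are read off from it. *)
Lemma young_defectS n q b :
  young_defect n.+1 q b =
  b * young_defect n q b + n.+1%:R * q ^+ n * (q - b) ^+ 2.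
Proof.
rewrite /young_defect !exprS -!natr1.
by ring.
Qed.

Lemma young_defect_ge0 n q b : 0 <= q -> 0 <= b -> 0 <= young_defect n q b.
Proof.
move=> q0 b0; elim: n => [|n IH].
  by rewrite /young_defect !expr1 expr0 mul0r mul1r mulr1 add0r addNr.
rewrite young_defectS; apply: addr_ge0; first exact: mulr_ge0.
by rewrite mulr_ge0 ?sqr_ge0// mulr_ge0// exprn_ge0.
Qed.

Lemma young_defect_le n q b : 0 <= q <= 1 -> 0 <= b <= 1 ->
  young_defect n q b <= n.+1%:R ^+ 2 * (q - b) ^+ 2.
Proof.
move=> /andP[q0 q1] /andP[b0 b1]; elim: n => [|n IH].
  by rewrite /young_defect !expr1 expr0 mul0r mul1r mulr1 add0r addNr
             mulr_ge0 ?sqr_ge0.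
rewrite young_defectS.
have h1 : b * young_defect n q b <= n.+1%:R ^+ 2 * (q - b) ^+ 2.
  by apply: le_trans IH; rewrite ler_piMl// young_defect_ge0.
have h2 : n.+1%:R * q ^+ n * (q - b) ^+ 2 <= n.+1%:R * (q - b) ^+ 2.
  by rewrite ler_wpM2r ?sqr_ge0// ler_piMr// exprn_ile1.
apply: le_trans (lerD h1 h2) _; rewrite -mulrDl ler_wpM2r ?sqr_ge0//.
rewrite -[n.+2%:R]natr1; have : 0 <= n.+1%:R :> K by [].
by nra.
Qed.

Lemma young_ineq n x y : 0 <= x -> 0 <= y ->
  n.+1%:R * x * y ^+ n <= x ^+ n.+1 + n%:R * y ^+ n.+1.
Proof. by move=> x0 y0; have := young_defect_ge0 n y0 x0; rewrite /young_defect; lra. Qed.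

(** Convexity of the power function, obtained by adding the tangent-line bounds
    at x + y for x / (1 - s) and y / s. It splits an L^N norm at a cost as
    close to 1 as desired on the first summand. *)
Lemma convex_exprn n s x y : 0 < s < 1 -> 0 <= x -> 0 <= y ->
  (x + y) ^+ n.+1 <= (1 - s) ^- n * x ^+ n.+1 + s ^- n * y ^+ n.+1.
Proof.
move=> /andP[s0 s1] x0 y0.
have s1' : 0 < 1 - s by rewrite subr_gt0.
have key a z : 0 < a -> 0 <= z ->
    n.+1%:R * z * (x + y) ^+ n - n%:R * a * (x + y) ^+ n.+1 <= a ^- n * z ^+ n.+1.
  move=> a0 z0; have := @young_ineq n (z / a) (x + y).
  rewrite divr_ge0 ?(ltW a0)// addr_ge0// => /(_ isT isT) h.
  have := ler_wpM2l (ltW a0) h.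
  have -> : a * (n.+1%:R * (z / a) * (x + y) ^+ n) = n.+1%:R * z * (x + y) ^+ n.
    by field; rewrite gt_eqF.
  rewrite mulrDr expr_div_n [a * (z ^+ _ / _)]mulrCA.
  rewrite [a / _](_ : _ = a ^- n); last first.
    by rewrite exprS invfM mulrA divff ?mul1r// gt_eqF.
  by lra.
have := lerD (key _ _ s1' x0) (key _ _ s0 y0).
apply: le_trans; rewrite -natr1 exprS le_eqVlt; apply/orP; left; apply/eqP.
by ring.
Qed.

Lemma ln_ge_1BV x : 0 < x -> 1 - x^-1 <= ln x.
Proof.
move=> x0; have x0' : 0 < x^-1 by rewrite invr_gt0.
have := @le_ln1Dx K (x^-1 - 1); rewrite subrKC lnV ?posrE// => h.
have : - ln x <= x^-1 - 1 by apply: h; rewrite ltrBrDr addNr.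
by lra.
Qed.

(** With q = beta the quantity (N - 1) (q^(N-1) - q^N) attains its maximum, the
    Hardy constant kappa. Moving q to beta + b r loses only the second-order
    quantity N^2 (b r)^2, while the derivative of the flux gains a term of
    order b r t; for b small the gain wins, and the surplus dominates
    (r t)^N because r t <= R. *)
Lemma radial_ineq m (R Rt b r : K) :
  let N : K := m.+2%:R in let beta := m.+1%:R / N in
  let kappa := beta ^+ m.+2 in
  let q := beta + b * r in let t := ln (R / r) in
  0 < r <= Rt -> Rt < R -> 0 < b -> N * (b * R) <= 1 ->
  2 * N ^+ 2 * (b * R) <= kappa * (1 - Rt / R) ->
  kappa + kappa * b / (2 * R ^+ m.+1) * (r ^+ m.+2 * t ^+ m.+2) <=
  m.+1%:R * (q ^+ m * (b * r * t + q) - q ^+ m.+2).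
Proof.
move=> N beta kappa q t /andP[r0 rRt] RtR b0 bR1 bR2.
have R0 : 0 < R by apply: lt_trans RtR; exact: lt_le_trans r0 rRt.
have N0 : 0 < N by rewrite ltr0n.
have beta0 : 0 < beta by rewrite divr_gt0// ltr0n.
have kappa0 : 0 < kappa by rewrite exprn_gt0.
have betaE : beta = 1 - N^-1.
  by rewrite /beta -[m.+1%:R](addrK 1) natr1 mulrBl divff ?gt_eqF// mul1r.
have rR : r < R by exact: le_lt_trans RtR.
have t_ge : 1 - Rt / R <= t.
  apply: le_trans (ln_ge_1BV _); last by rewrite divr_gt0.
  by rewrite invf_div lerD2l lerN2 ler_wpM2r// invr_ge0 ltW.
have t0 : 0 < t by apply: lt_le_trans t_ge; rewrite subr_gt0 ltr_pdivrMr// mul1r.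
have rt : r * t <= R.
  rewrite mulrC -ler_pdivlMr//; apply/ltW/ln_sublinear.
  by rewrite divr_gt0.
have br0 : 0 < b * r by rewrite mulr_gt0.
have bR : b * r <= b * R by rewrite ler_wpM2l// ltW.
have q1 : q <= 1.
  rewrite /q betaE.
  have : b * R <= N^-1 by rewrite -[N^-1]mul1r ler_pdivlMr// mulrC.
  by move: (N^-1) bR => z; lra.
have bq : beta <= q by rewrite lerDl ltW.
have beta1 : beta <= 1 by exact: le_trans q1.
have q0 : 0 <= q by rewrite (le_trans _ bq)// ltW.
have := @young_defect_le m.+1 q beta.
rewrite q0 q1 beta1 (ltW beta0) => /(_ isT isT).
have -> : young_defect m.+1 q beta =
    m.+1%:R * q ^+ m.+2 - m.+1%:R * q ^+ m.+1 + kappa.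
  by rewrite /young_defect [_ * beta]mulrC divfK ?gt_eqF.
have -> : q - beta = b * r by rewrite /q addrC addKr.
move=> hE.
have h1 : N ^+ 2 * (b * r) ^+ 2 <= kappa / 2 * (b * r * t).
  have : N ^+ 2 * (b * r) <= kappa / 2 * t.
    have : N ^+ 2 * (b * r) <= N ^+ 2 * (b * R) by apply: ler_wpM2l bR; exact: sqr_ge0.
    have : kappa * (1 - Rt / R) <= kappa * t by apply: ler_wpM2l t_ge; exact: ltW.
    move: bR2; set d := 1 - _; rewrite [kappa / 2 * t]mulrAC.
    move: (kappa * d) (kappa * t) (N ^+ 2 * (b * r)) => u v w.
    rewrite -mulrA; move: (N ^+ 2 * _) => z.
    lra.
  move/(ler_wpM2l (ltW br0)).
  have -> : b * r * (N ^+ 2 * (b * r)) = N ^+ 2 * (b * r) ^+ 2 by ring.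
  by have -> : b * r * (kappa / 2 * t) = kappa / 2 * (b * r * t) by ring.
have h2 : kappa * b / (2 * R ^+ m.+1) * (r ^+ m.+2 * t ^+ m.+2) <=
    kappa / 2 * (b * r * t).
  have -> : r ^+ m.+2 * t ^+ m.+2 = (r * t) ^+ m.+1 * (r * t).
    by rewrite -exprMn -exprSr.

  have h : (r * t) ^+ m.+1 <= R ^+ m.+1.
    by rewrite lerXn2r// nnegrE ?mulr_ge0 ?ltW.
  have Rm : 0 < R ^+ m.+1 by rewrite exprn_gt0.
  have -> : kappa * b / (2 * R ^+ m.+1) * ((r * t) ^+ m.+1 * (r * t)) =
      kappa / 2 * (b * r * t) * ((r * t) ^+ m.+1 / R ^+ m.+1).
    by field; rewrite gt_eqF.
  rewrite ler_piMr ?ler_pdivrMr ?mul1r//.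
  apply: mulr_ge0; first by rewrite divr_ge0// ltW.
  by rewrite mulr_ge0 ?ltW.
have h3 : kappa * (b * r * t) <= m.+1%:R * (q ^+ m * (b * r * t)).
  rewrite mulrA; apply: ler_wpM2r; first by rewrite mulr_ge0 ?ltW.
  have h : kappa <= q ^+ m.
    rewrite /kappa -[m.+2]addn2 exprD.
    have : beta ^+ m <= q ^+ m by rewrite lerXn2r// nnegrE ltW.
    apply: le_trans; rewrite ler_piMr ?exprn_ge0 ?(ltW beta0)//.
    by rewrite exprn_ile1 ?(ltW beta0).
  by apply: le_trans h _; rewrite ler_peMl ?exprn_ge0// ler1n.
rewrite [q ^+ m * (_ + q)]mulrDr -exprSr mulrBr mulrDr.
move: hE h1 h2 h3; lra.
Qed.
End algebra.

(** * Borel structure and integrability on row vectors *)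

Section rV_topology.
Variables (K : realType).
Implicit Types n : nat.

Lemma coord_le_norm n (x : 'rV[K]_n) i : `|x ord0 i| <= `|x|.
Proof.
rewrite [leRHS]/Num.norm/= mx_normrE.
by apply: (le_bigmax _ (fun ij : 'I_1 * 'I_n => `|x ij.1 ij.2|) (ord0, i)).
Qed.

Lemma norm_leP n (x : 'rV[K]_n) (M : K) : 0 <= M ->
  (forall i, `|x ord0 i| <= M) -> `|x| <= M.
Proof.
move=> M0 xM; rewrite [leLHS]/Num.norm/= mx_normrE.
by apply/bigmax_leP; split => // -[i j] _ /=; rewrite ord1.
Qed.

Lemma ball_rVE n (x y : 'rV[K]_n) (e : K) : 0 < e ->
  ball x e y <-> forall i, `|x ord0 i - y ord0 i| < e.
Proof.
move=> e0; split => [[_]|xy]; first by move=> xy i; exact: xy.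
by split => // i j; rewrite ord1; exact: xy.
Qed.

(** An open set is the union of the countably many boxes with rational centre
    and radius 1/(k+1) that it contains, and boxes are generated by the
    coordinates. *)
Lemma open_measurable_rV n (U : set 'rV[K]_n) : open U -> measurable U.
Proof.
move=> oU.
pose B (p : 'rV[rat]_n * nat) : set 'rV[K]_n :=
  [set x | forall i, `|ratr (p.1 ord0 i) - x ord0 i| < p.2.+1%:R^-1].
pose V p := if pselect (B p `<=` U) then B p else set0.
have mB p : measurable (B p).
  have -> : B p = \bigcap_(i in [set: 'I_n]) (@rV_coord K n i @^-1`
      [set t | `|ratr (p.1 ord0 i) - t| < p.2.+1%:R^-1]).
    by apply/seteqP; split => x /= Bx i; [move=> _|]; exact: Bx.
  apply: fin_bigcap_measurable => // i _.
  rewrite -[X in measurable X]setTI; apply: measurable_rV_coord => //.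
  rewrite (_ : [set _ | _] = ball (ratr (p.1 ord0 i) : K) (p.2.+1%:R^-1))//.
  by apply: open_measurable; exact: ball_open.
have -> : U = \bigcup_p V p.
  apply/seteqP; split => [x Ux|x [p _]]; last first.
    by rewrite /V; case: pselect => // pU /pU.
  have /nbhs_ballP[e /= e0 xU] : nbhs x U by exact: open_nbhs_nbhs.
  have [k ke] : exists k : nat, 2 * k.+1%:R^-1 < e.
    have [k _ /(_ k (leqnn _)) h] := near_infty_natSinv_lt (PosNum (divr_gt0 e0 (ltr0n _ 2))).
    by exists k; rewrite mulrC -ltr_pdivlMr.
  have k0 : 0 < k.+1%:R^-1 :> K by rewrite invr_gt0.
  have /choice[q qx] : forall i, exists q : rat, `|ratr q - x ord0 i| < k.+1%:R^-1.
    move=> i; have [q] := @rat_in_itvoo K (x ord0 i) (x ord0 i + k.+1%:R^-1)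
      ltac:(by rewrite ltrDl).
    rewrite in_itv/= => /andP[h1 h2]; exists q.
    by rewrite gtr0_norm ?subr_gt0// ltrBlDl.
  exists (\row_i q i, k) => //; rewrite /V; case: pselect => /= [_ i|].
    by rewrite mxE; exact: qx.
  case => y By; apply: xU; apply/ball_rVE => // i.
  have := By i; rewrite /= mxE => yq.
  rewrite (le_lt_trans (ler_distD (ratr (q i)) _ _))//.
  by rewrite (lt_trans _ ke)// mulr_natl mulr2n ltrD// distrC.
apply: countable_bigcupT_measurable; first exact: countableP.
by move=> p; rewrite /V; case: pselect => ?; [exact: mB|exact: measurable0].
Qed.

Lemma continuous_measurable_rV n (f : 'rV[K]_n -> K) :
  continuous f -> measurable_fun setT f.
Proof.
move=> /continuousP cf; apply: (measurability _ (RGenOpens.measurableE K)).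
move=> _ [_ [a [b ->] <-]]; rewrite setTI; apply: open_measurable_rV.
exact/cf/interval_open.
Qed.

Lemma compact_box n (M : K) : compact [set x : 'rV[K]_n | `|x| <= M].
Proof.
apply: bounded_closed_compact.
  exists M; split; first exact: num_real.
  by move=> y My x /= xM; exact: le_trans (ltW My).
rewrite (_ : mkset _ = (fun x : 'rV[K]_n => `|x|) @^-1` [set t | t <= M])//.
by move/continuous_closedP: (@norm_continuous K 'rV[K]_n); apply; exact: closed_le.
Qed.

Lemma measurable_box n (M : K) : measurable [set x : 'rV[K]_n | `|x| <= M].
Proof.
rewrite -[X in measurable X]setCK; apply: measurableC.
by apply: open_measurable_rV; rewrite openC; apply: compact_closed;
  [exact: norm_hausdorff|exact: compact_box].
Qed.

Lemma lebesgue_box_le n (A : set 'rV[K]_n) (M : K) : 0 <= M -> measurable A ->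
  (forall x, A x -> forall i, `|x ord0 i| <= M) ->
  (lebesgue_rV K n A <= ((2 * M) ^+ n)%:E)%E.
Proof.
move=> M0 mA AM.
pose I : 'I_n -> set (measurableTypeR K) := fun=> `[- M, M]%classic.
have mI i : measurable (I i) by exact: measurable_itv.
have lI : lebesgue_measure (`[- M, M]%classic : set (measurableTypeR K)) = (2 * M)%:E.
  rewrite lebesgue_measure_itv/= lte_fin; case: ltP => [_|].
    by rewrite -EFinD opprK mulr_natl mulr2n.
  move=> h; have -> : M = 0 by lra.
  by rewrite mulr0.
have := lebesgue_rV_box mI.
rewrite (eq_bigr (fun=> (2 * M)%:E)); last by move=> i _; exact: lI.
rewrite big_const_ord.
have -> : iter n (mule (2 * M)%:E) 1%E = ((2 * M) ^+ n)%:E.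
  by elim: (n) => //= k ->; rewrite -EFinM exprS.
have mbox : measurable [set x : 'rV[K]_n | forall i, I i (x ord0 i)].
  rewrite (_ : mkset _ = \bigcap_(i in [set: 'I_n]) (@rV_coord K n i @^-1` I i)).
    apply: fin_bigcap_measurable => // i _.
    by rewrite -[X in measurable X]setTI; exact: measurable_rV_coord.
  by apply/seteqP; split => y /= Ay i; [move=> _|]; exact: Ay.
move=> <-; apply: le_measure; rewrite ?inE//.
by move=> x Ax i; rewrite /I/= in_itv/= -ler_norml; exact: AM.
Qed.

Lemma continuous_bounded n (f : 'rV[K]_n -> K) (M : K) : continuous f ->
  exists2 B : K, 0 < B & forall x, `|x| <= M -> `|f x| <= B.
Proof.
move=> cf; have : compact (f @` [set x | `|x| <= M]).
  by apply: continuous_compact (@compact_box n M); exact: continuous_subspaceT.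
move=> /compact_bounded[B [_ fB]]; exists (Num.max B 0 + 1).
  by rewrite ltr_wpDl// le_max lexx orbT.
move=> x xM; apply: fB; last by exists x.
by rewrite (le_lt_trans (_ : _ <= Num.max B 0))// ?ltrDl// le_max lexx.
Qed.

Lemma box_integrable n (f : 'rV[K]_n -> K) (M B : K) : measurable_fun setT f ->
  (forall x, M < `|x| -> f x = 0) -> (forall x, `|f x| <= B) ->
  (lebesgue_rV K n).-integrable setT (EFin \o f).
Proof.
move=> mf f0 fB.
have -> : EFin \o f = (EFin \o f) \_ [set x | `|x| <= Num.max M 0].
  apply/funext => x /=; rewrite patchE; case: ifPn => //.
  rewrite notin_setE /= => /negP; rewrite -ltNge => h.
  have -> // : f x = 0 by apply: f0; apply: (le_lt_trans _ h); rewrite le_max lexx.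
apply: (iffLR (integrable_mkcond _ (@measurable_box n (Num.max M 0)))).
apply: measurable_bounded_integrable.
- exact: measurable_box.
- apply: le_lt_trans (ltry ((2 * Num.max M 0) ^+ n)).
  apply: lebesgue_box_le; first by rewrite le_max lexx orbT.
    exact: measurable_box.
  by move=> x /= xM i; exact: le_trans (coord_le_norm _ _) xM.
- exact: measurable_funTS.
- exists B; split; first exact: num_real.
  by move=> C BC x _; exact: le_trans (fB x) (ltW BC).
Qed.
End rV_topology.

(** * Integrals of partial derivatives vanish *)

Section divergence.
Variables (K : realType).
Implicit Types n : nat.
Local Notation mu := (@lebesgue_measure K).

Lemma cons_rV_continuous n (a : K) : continuous (fun y : 'rV[K]_n => cons_rV (a, y)).
Proof.
move=> y A /nbhs_ballP[e /= e0 eA]; apply/nbhs_ballP; exists e => //= z.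
move=> /(ball_rVE _ _ e0) yz; apply: eA; apply/ball_rVE => // i; rewrite !mxE.
by case: (unliftP ord0 i) => [j _|_] /=; rewrite ?subrr ?normr0//; exact: yz.
Qed.

Lemma norm_cons_rV n (a : K) (y : 'rV[K]_n) : `|y| <= `|cons_rV (a, y)|.
Proof.
apply: norm_leP => // i.
by have := coord_le_norm (cons_rV (a, y)) (lift ord0 i); rewrite mxE liftK.
Qed.

Lemma cons_rV_line0 n (a : K) (y : 'rV[K]_n) :
  cons_rV (a, y) = cons_rV (0, y) + a *: delta_mx ord0 ord0.
Proof.
apply/rowP => i; rewrite !mxE eqxx /=; case: (unliftP ord0 i) => [j ->|->] /=.
  by rewrite mulr0 addr0.
by rewrite mulr1 add0r.
Qed.

Lemma cons_rV_lineS n (a h : K) (y : 'rV[K]_n) j :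
  cons_rV (a, y + h *: delta_mx ord0 j) =
  cons_rV (a, y) + h *: delta_mx ord0 (lift ord0 j).
Proof.
apply/rowP => i; rewrite !mxE eqxx /=; case: (unliftP ord0 i) => [k ->|->] /=.
  by rewrite !mxE eqxx/= (inj_eq lift_inj).
by rewrite mulr0 addr0.
Qed.

(** Fubini, in the order that puts coordinate i innermost. The measure is built
    by adjoining coordinate 0 to the left, hence the induction on the dimension:
    it peels off coordinate 0 until it is the one of interest. *)
Lemma integral_lines_eq0 n (i : 'I_n) (f : 'rV[K]_n -> K) (M : K) :
  continuous f -> (forall x, M < `|x| -> f x = 0) ->
  (forall x, \int[mu]_h (f (x + h *: delta_mx ord0 i))%:E = 0)%E ->
  (\int[lebesgue_rV K n]_x (f x)%:E = 0)%E.
Proof.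
elim: n => [[]//|n IH] in i f *; move=> cf f0 fi.
have mf : measurable_fun setT f by exact: continuous_measurable_rV.
have [B _ fB] := continuous_bounded M cf.
have fB' x : `|f x| <= Num.max B 0.
  have [xM|Mx] := leP `|x| M; first by rewrite le_max fB.
  by rewrite f0// normr0 le_max lexx orbT.
have intf := box_integrable mf f0 fB'.
pose m := lebesgue_rV K n.
have intg : (mu \x m)%E.-integrable setT ((EFin \o f) \o @cons_rV K n).
  have mg : measurable_fun setT ((EFin \o f) \o @cons_rV K n).
    by apply: measurableT_comp (@measurable_cons_rV K n); exact/measurable_EFinP.
  apply/integrableP; split => //.
  have /integrableP[_] := intf; apply: le_lt_trans.
  rewrite [leRHS](ge0_integral_pushforward (@measurable_cons_rV K n))//.
  by do 2!apply: measurableT_comp => //.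
have -> : (\int[lebesgue_rV K n.+1]_x (f x)%:E =
    \int[(mu \x m)]_z ((EFin \o f) \o @cons_rV K n) z)%E.
  rewrite -[LHS]/(\int[pushforward (mu \x m)%E (@cons_rV K n)]_x (f x)%:E)%E.
  rewrite (@integral_pushforward _ _ _ _ _ _ (@measurable_cons_rV K n))//.
  exact/measurable_EFinP.
have [j ij|i0] := unliftP ord0 i.
  rewrite -fubini1// -[RHS](integral0 mu setT); apply: eq_integral => a _.
  apply: (IH j (fun y => f (cons_rV (a, y)))).
  - by move=> y; apply: continuous_comp; [exact: cons_rV_continuous|exact: cf].
  - by move=> y My; apply: f0; exact: lt_le_trans My (norm_cons_rV _ _).
  - by move=> y; under eq_integral do rewrite cons_rV_lineS -ij; exact: fi.
rewrite -fubini2// -[RHS](integral0 m setT); apply: eq_integral => y _.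
rewrite /fubini_G /=; under eq_integral do rewrite cons_rV_line0 -i0.
exact: fi.
Qed.

Lemma integral_derive_line_eq0 (g G : K -> K) (M : K) :
  continuous g -> (forall h : K, is_derive h 1 G (g h)) ->
  (forall h, M < `|h| -> G h = 0) -> (forall h, M < `|h| -> g h = 0) ->
  (\int[mu]_h (g h)%:E = 0)%E.
Proof.
move=> cg dG G0 g0; pose L := Num.max M 0 + 1.
have ML h : L <= `|h| -> M < `|h|.
  by apply: lt_le_trans; rewrite (le_lt_trans (_ : _ <= Num.max M 0))// ?ltrDl// le_max lexx.
have L0 : 0 < L by rewrite ltr_wpDl// le_max lexx orbT.
have dG' h : derivable G h 1 by have [] := dG h.
have cG : continuous G by move=> h; apply/differentiable_continuous/derivable1_diffP.
pose L' := - L.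
have : (\int[mu]_(x in `[L', L]) (g x)%:E)%E = ((G L)%:E - (G L')%:E)%E.
  apply: continuous_FTC2.
  - by rewrite gtrN.
  - exact: continuous_subspaceT.
  - split => //; [exact: cvg_at_right_filter (cG _)|exact: cvg_at_left_filter (cG _)].
  - by move=> h _; rewrite derive1E derive_val.
rewrite /L' !G0 ?subee// ?ML ?normrN ?ger0_norm// ?ltW// integral_mkcond => <-.
apply: eq_integral => h _; rewrite patchE; case: ifPn => //.
rewrite notin_setE /= in_itv /= -ler_norml => /negP; rewrite -ltNge => hL.
by rewrite g0// ML// ltW.
Qed.

(** The divergence theorem for compactly supported fields, one component at a
    time. The derivative is only required along lines, which is what smoothness
    of a test function provides. *)
Lemma integral_partial_eq0 n (i : 'I_n) (f psi : 'rV[K]_n -> K) (M : K) :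
  continuous f ->
  (forall x, is_derive (0 : K) 1 (fun h => psi (x + h *: delta_mx ord0 i)) (f x)) ->
  (forall x, M < `|x| -> psi x = 0) -> (forall x, M < `|x| -> f x = 0) ->
  (\int[lebesgue_rV K n]_x (f x)%:E = 0)%E.
Proof.
move=> cf dpsi psi0 f0; apply: (integral_lines_eq0 (i := i) cf f0) => x.
set e := delta_mx ord0 i.
have norm_e h : `|h| <= `|x + h *: e| + `|x|.
  have <- : `|h *: e| = `|h|.
    rewrite normrZ (_ : `|e| = 1) ?mulr1//; apply/eqP; rewrite eq_le; apply/andP; split.
      apply: norm_leP => // k; rewrite mxE eqxx /=; case: eqP => _ /=; rewrite ?normr1// normr0.
      exact: ler01.
    by have := coord_le_norm e i; rewrite mxE !eqxx /= normr1.
  by rewrite -[leLHS](_ : `|(x + h *: e) - x| = _) ?ler_normB// addrC addKr.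
have far h : M + `|x| < `|h| -> M < `|x + h *: e|.
  by move=> /lt_le_trans/(_ (norm_e h)); rewrite ltrD2r.
apply: (@integral_derive_line_eq0 _ (fun h => psi (x + h *: e)) (M + `|x|)).
- move=> h; apply: (@continuous_comp _ _ _ (fun h : K => x + h *: e) f); last exact: cf.
  apply: cvgD; first exact: cvg_cst.
  by apply: cvgZl; exact: cvg_id.
- move=> h; have := dpsi (x + h *: e).
  have -> : (fun k : K => psi (x + h *: e + k *: e)) =
     (fun k => psi (x + k *: e)) \o (fun k => k + h).
    by apply/funext => k /=; rewrite -addrA -scalerDl [h + k]addrC.
  move=> d; have sh : is_derive h 1 (fun k : K => k - h) 1.
    by rewrite -[X in is_derive _ _ _ X]subr0; exact: is_deriveB.
  have := @is_derive1_comp _ ((fun k => psi (x + k *: e)) \o (fun k => k + h))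
    (fun k => k - h) h (f (x + h *: e)) 1.
  rewrite subrr mulr1 => /(_ d sh).
  by congr is_derive; apply/funext => k /=; rewrite subrK.
- by move=> h /far/psi0.
- by move=> h /far/f0.
Qed.
End divergence.

(** * Pointwise calculus *)

(* The rules below are stated for functions written pointwise, so that they
   unify with the explicit formulas of the radial field. *)
Section continuity_at.
Variables (K : realType) (T : topologicalType).
Implicit Types (f g : T -> K) (x : T).

Lemma continuous_mul f g x : {for x, continuous f} -> {for x, continuous g} ->
  {for x, continuous (fun y => f y * g y)}.
Proof. by move=> cf cg; apply: cvgM. Qed.

Lemma continuous_add f g x : {for x, continuous f} -> {for x, continuous g} ->
  {for x, continuous (fun y => f y + g y)}.
Proof. by move=> cf cg; apply: cvgD. Qed.

Lemma continuous_opp f x : {for x, continuous f} ->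
  {for x, continuous (fun y => - f y)}.
Proof. by move=> cf; apply: cvgN. Qed.

Lemma continuous_cst (c : K) x : {for x, continuous (fun=> c : K)}.
Proof. exact: cvg_cst. Qed.

Lemma continuous_pow f n x : {for x, continuous f} ->
  {for x, continuous (fun y => f y ^+ n)}.
Proof.
move=> cf; elim: n => [|n IH]; first exact: continuous_cst.
have -> : (fun y => f y ^+ n.+1) = (fun y => f y * f y ^+ n).
  by apply/funext => y; rewrite exprS.
exact: continuous_mul.
Qed.

Lemma continuous_inv f x : f x != 0 -> {for x, continuous f} ->
  {for x, continuous (fun y => (f y)^-1)}.
Proof. by move=> f0 cf; apply: cvgV. Qed.

Lemma continuous_abs f x : {for x, continuous f} ->
  {for x, continuous (fun y => `|f y|)}.
Proof. by move=> cf; apply: cvg_norm. Qed.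

Lemma continuous_comp_fun f (h : K -> K) x : {for x, continuous f} ->
  {for f x, continuous h} -> {for x, continuous (fun y => h (f y))}.
Proof. exact: continuous_comp. Qed.

End continuity_at.

Section profile.
Variable K : realType.
Implicit Types (x y r s a b : K) (f g : K -> K).

Lemma is_derive_mul f g x a b : is_derive x 1 f a -> is_derive x 1 g b ->
  is_derive x 1 (fun h => f h * g h) (f x * b + g x * a).
Proof. exact: is_deriveM. Qed.

Lemma is_derive_add f g x a b : is_derive x 1 f a -> is_derive x 1 g b ->
  is_derive x 1 (fun h => f h + g h) (a + b).
Proof. exact: is_deriveD. Qed.

Lemma is_derive_const (c : K) x : is_derive x 1 (fun=> c : K) 0.
Proof. exact: is_derive_cst. Qed.

Lemma is_derive_var x : is_derive x 1 (fun h : K => h) 1.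
Proof. exact: is_derive_id. Qed.

Lemma is_derive_comp_fun f g x a b : is_derive (g x) 1 f a ->
  is_derive x 1 g b -> is_derive x 1 (fun h => f (g h)) (a * b).
Proof. exact: is_derive1_comp. Qed.

Lemma is_derive_exp f n x a : is_derive x 1 f a ->
  is_derive x 1 (fun h => f h ^+ n) (n%:R * f x ^+ n.-1 * a).
Proof.
move=> df; have -> : (fun h => f h ^+ n) = f ^+ n by apply/funext => h; rewrite fctE.
exact: is_deriveX.
Qed.

Lemma is_derive_inv f x a : f x != 0 -> is_derive x 1 f a ->
  is_derive x 1 (fun h => (f h)^-1) (- (f x ^- 2) * a).
Proof. by move=> f0 df; exact: is_deriveV. Qed.

(** Away from 0 this is the derivative of a monomial; at 0 the difference
    quotient is |h|^m h, which is continuous. *)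
Lemma is_derive_norm_exp m y :
  is_derive y 1 (fun y : K => `|y| ^+ m.+2) (m.+2%:R * (`|y| ^+ m * y)).
Proof.
have [y0|y0|->] := ltgtP y 0.
- apply: (@near_eq_is_derive K K K (fun h : K => (- h) ^+ m.+2)).
    near=> z; rewrite ltr0_norm//; near: z.
    exact: lt_nbhsl.
  apply: (is_derive_eq (is_derive_exp m.+2 (is_deriveN (is_derive_var y)))) => /=.
  by rewrite fctE (ltr0_norm y0) exprSr; ring.
- apply: (@near_eq_is_derive K K K (fun h : K => h ^+ m.+2)).
    near=> z; rewrite gtr0_norm//; near: z.
    exact: lt_nbhsr.
  apply: (is_derive_eq (is_derive_exp m.+2 (is_derive_var y))) => /=.
  by rewrite (gtr0_norm y0) exprSr; ring.
- pose k h : K := `|h| ^+ m * h.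
  have ck : k h @[h --> 0^'] --> (0 : K).
    have k0 : k 0 = 0 by rewrite /k mulr0.
    rewrite -[X in _ --> X]k0; apply: cvg_within_filter.
    apply: (@continuousM K K (fun h => `|h| ^+ m) id 0); last exact: cvg_id.
    apply: (@continuous_comp _ _ _ (fun h : K => `|h|) (fun h => h ^+ m)).
      exact: norm_continuous.
    by apply: exprn_continuous.
  pose quot (h : K) := h^-1 *: (((fun y : K => `|y| ^+ m.+2) \o shift 0) (h *: 1)
    - (fun y : K => `|y| ^+ m.+2) 0).
  have kq : \forall h \near (0 : K)^', k h = quot h.
    near=> h; have h0 : h != 0 by near: h; exact: nbhs_dnbhs_neq.
    rewrite /quot /= /k normr0 expr0n subr0 addr0 /=.
    rewrite /GRing.scale/= mulr1 -[m.+2]addn2 exprD real_normK ?num_real//.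
    by field.
  have lim0 : quot h @[h --> 0^'] --> (0 : K).
    exact: cvg_trans (near_eq_cvg kq) ck.
  rewrite mulr0 mulr0; split; first by apply/cvg_ex; exists 0.
  exact: cvg_lim lim0.
Unshelve. all: by end_near.
Qed.

(** The cutoff uses the cube of the positive part because it is continuously
    differentiable. Writing the positive part with the absolute value
    makes its continuity and the derivative of its cube immediate. *)
Definition pospart (s : K) : K := (s + `|s|) / 2.

Lemma pospartE s : pospart s = Num.max s 0.
Proof.
rewrite /pospart; case: (lerP 0 s) => s0.
  by rewrite ger0_norm//; field.
by rewrite ltr0_norm// subrr mul0r.
Qed.

Lemma is_derive_pospart_cube s :
  is_derive s 1 (fun s => pospart s ^+ 3) (3 * pospart s ^+ 2).
Proof.
have -> : (fun s => pospart s ^+ 3) = (fun h => (h ^+ 3 + `|h| ^+ 3) * 2^-1).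
  apply/funext => h; rewrite /pospart; case: (lerP 0 h) => h0.
    by rewrite ger0_norm//; field.
  by rewrite ltr0_norm//; field.
have d3 := is_derive_exp 3 (is_derive_var s).
have d4 := is_derive_add d3 (is_derive_norm_exp 1 s).
have d5 := is_derive_mul d4 (is_derive_const (2^-1 : K) s).
apply: (is_derive_eq d5).
rewrite /pospart /= !expr1; case: (lerP 0 s) => s0.
  by rewrite ger0_norm//; field.
by rewrite ltr0_norm//; field.
Qed.

Lemma pospart_continuous : continuous pospart.
Proof.
move=> s; apply: (@continuous_mul K K (fun s => s + `|s|) (fun=> 2^-1) s).
  2: exact: continuous_cst.
by apply: continuous_add; [exact: cvg_id|exact: norm_continuous].
Qed.

(** ** The radial flux profile *)

Variables (m : nat) (R beta slope eps : K).

(** With t = ln (R / r) and q = beta + slope r, the field is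
    x -> profile |x| *: x with profile = chi (q / t)^(N-1) / r^N, where
    chi = (r - eps)_+^3 / r^3 is the cutoff near the origin, N = m.+2, and
    wratio = q / t. For slope = 0 this is the field for which the vector-field
    proof of the sharp critical Hardy inequality formally has equality at the virtual
    extremizer. *)
Definition wratio r : K := (beta + slope * r) / ln (R / r).
Definition dwratio r : K :=
  (slope * r * ln (R / r) + (beta + slope * r)) / (r * ln (R / r) ^+ 2).
Definition profile r : K :=
  pospart (r - eps) ^+ 3 * wratio r ^+ m.+1 / r ^+ (m + 5).
Definition dprofile r : K :=
  pospart (r - eps) ^+ 2 * wratio r ^+ m / r ^+ (m + 6) *
  (3 * wratio r * r + pospart (r - eps) * (m.+1%:R * dwratio r * r) -
   (m + 5)%:R * (pospart (r - eps) * wratio r)).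

Hypothesis R0 : 0 < R.

Lemma ln_ratio_gt0 r : 0 < r < R -> 0 < ln (R / r).
Proof. by move=> /andP[r0 rR]; rewrite ln_gt0// ltr_pdivlMr// mul1r. Qed.

Lemma is_derive_ln_ratio r : 0 < r -> is_derive r 1 (fun r => ln (R / r)) (- r^-1).
Proof.
move=> r0; have dV := is_derive_mul (is_derive_const R r)
  (@is_derive_inv (fun h => h) r 1 (lt0r_neq0 r0) (is_derive_var r)).
have Rr : 0 < R / r by rewrite divr_gt0.
apply: (is_derive_eq (@is_derive_comp_fun (@ln K) (fun r => R / r) r _ _
  (is_derive1_ln Rr) dV)) => /=.
by field; rewrite !gt_eqF.
Qed.

Lemma is_derive_wratio r : 0 < r < R -> is_derive r 1 wratio (dwratio r).
Proof.
move=> rR; have t0 := ln_ratio_gt0 rR; have /andP[r0 _] := rR.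
have d1 := is_derive_add (is_derive_const beta r)
  (is_derive_mul (is_derive_const slope r) (is_derive_var r)).
have d2 := @is_derive_inv (fun r => ln (R / r)) r _ (lt0r_neq0 t0) (is_derive_ln_ratio r0).
apply: (is_derive_eq (is_derive_mul d1 d2)) => /=.
by rewrite /dwratio; field; rewrite !gt_eqF.
Qed.

Lemma is_derive_profile r : 0 < r < R -> is_derive r 1 profile (dprofile r).
Proof.
move=> rR; have /andP[r0 _] := rR.
have dz : is_derive r 1 (fun r => pospart (r - eps) ^+ 3) (3 * pospart (r - eps) ^+ 2).
  have ds := is_derive_add (is_derive_var r) (is_derive_const (- eps) r).
  by apply: (is_derive_eq (@is_derive_comp_fun (fun s => pospart s ^+ 3) (fun r => r - eps)
    r _ _ (is_derive_pospart_cube (r - eps)) ds)); rewrite addr0 mulr1.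
have dw := is_derive_exp m.+1 (is_derive_wratio rR).
have rn0 : r ^+ (m + 5) != 0 by rewrite expf_neq0// gt_eqF.
have dr := @is_derive_inv (fun r => r ^+ (m + 5)) r _ rn0
  (is_derive_exp (m + 5) (is_derive_var r)).
apply: (is_derive_eq (is_derive_mul (is_derive_mul dz dw) dr)) => /=.
rewrite /dprofile addnS/= !exprS !addnS !exprS.
move: (wratio r) (dwratio r) (pospart _) => w dw' z.
by field; rewrite !gt_eqF// exprn_gt0.
Qed.

Lemma dprofile_continuous r : 0 < r < R -> {for r, continuous dprofile}.
Proof.
move=> rR; have /andP[r0 _] := rR; have t0 := ln_ratio_gt0 rR.
have cid : {for r, continuous (fun r : K => r)} by exact: cvg_id.
have cz : {for r, continuous (fun r => pospart (r - eps))}.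
  apply: (@continuous_comp_fun K K (fun r => r - eps) pospart); last exact: pospart_continuous.
  by apply: continuous_add => //; exact: continuous_cst.
have ct : {for r, continuous (fun r => ln (R / r))}.
  apply: (@continuous_comp_fun K K (fun r => R / r) (@ln K)).
    apply: continuous_mul; first exact: continuous_cst.
    by apply: continuous_inv => //; rewrite gt_eqF.
  by apply: continuous_ln; rewrite divr_gt0.
have cq : {for r, continuous (fun r => beta + slope * r)}.
  apply: continuous_add; first exact: continuous_cst.
  by apply: continuous_mul => //; exact: continuous_cst.
have cw : {for r, continuous wratio}.
  by apply: continuous_mul => //; apply: continuous_inv => //; rewrite gt_eqF.
have cdw : {for r, continuous dwratio}.
  apply: continuous_mul.
    apply: continuous_add => //; apply: continuous_mul => //.
    by apply: continuous_mul => //; exact: continuous_cst.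
  apply: continuous_inv; first by rewrite gt_eqF// mulr_gt0// exprn_gt0.
  by apply: continuous_mul => //; exact: continuous_pow.
apply: continuous_mul.
  apply: continuous_mul.
    by apply: continuous_mul; exact: continuous_pow.
  by apply: continuous_inv; [rewrite expf_neq0// gt_eqF|exact: continuous_pow].
apply: continuous_add.
  apply: continuous_add.
    by apply: continuous_mul => //; apply: continuous_mul => //; exact: continuous_cst.
  apply: continuous_mul => //; apply: continuous_mul => //.
  by apply: continuous_mul => //; exact: continuous_cst.
apply: continuous_opp; apply: continuous_mul; first exact: continuous_cst.
exact: continuous_mul.
Qed.

Lemma profile_eq0 r : r <= eps -> profile r = 0.
Proof.
by move=> re; rewrite /profile pospartE max_r ?subr_le0// expr0n/= !mul0r.
Qed.

Lemma dprofile_eq0 r : r <= eps -> dprofile r = 0.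
Proof.
by move=> re; rewrite /dprofile pospartE max_r ?subr_le0// expr0n/= !mul0r.
Qed.

Definition cutoff r : K := pospart (r - eps) ^+ 3 / r ^+ 3.

Lemma cutoff01 r : 0 < r -> 0 <= eps -> 0 <= cutoff r <= 1.
Proof.
move=> r0 e0; have z0 : 0 <= pospart (r - eps) by rewrite pospartE le_max lexx orbT.
have zr : pospart (r - eps) <= r.
  by rewrite pospartE ge_max (ltW r0) gerBl e0.
rewrite /cutoff divr_ge0 ?exprn_ge0 ?(ltW r0)//= ler_pdivrMr ?exprn_gt0// mul1r.
by rewrite lerXn2r// nnegrE ?(ltW r0).
Qed.

Lemma profileE r : 0 < r < R ->
  profile r * r = cutoff r * ((beta + slope * r) / (r * ln (R / r))) ^+ m.+1.
Proof.
move=> rR; have t0 := ln_ratio_gt0 rR; have /andP[r0 _] := rR.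
rewrite /profile /cutoff /wratio !expr_div_n exprMn !addnS addn0 !exprS.
by field; rewrite !expf_neq0 ?gt_eqF.
Qed.

(** The divergence of the field. The cutoff is nondecreasing in r and the flux is
    positive, so differentiating the cutoff contributes a nonnegative term: no
    boundary term has to be estimated at the origin. *)
Lemma div_profile_ge r : 0 < r < R -> 0 <= eps -> 0 <= beta + slope * r ->
  cutoff r * (m.+1%:R * ((beta + slope * r) ^+ m *
     (slope * r * ln (R / r) + (beta + slope * r))) / (r * ln (R / r)) ^+ m.+2) <=
  m.+2%:R * profile r + r * dprofile r.
Proof.
move=> rR e0 q0; have t0 := ln_ratio_gt0 rR; have /andP[r0 _] := rR.
have w0 : 0 <= wratio r by rewrite divr_ge0// ltW.
have z0 : 0 <= pospart (r - eps) by rewrite pospartE le_max lexx orbT.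
have zr : pospart (r - eps) <= r.
  by rewrite pospartE ge_max (ltW r0) gerBl e0.
have -> : m.+2%:R * profile r + r * dprofile r =
  3 * pospart (r - eps) ^+ 2 * wratio r ^+ m.+1 / r ^+ (m + 5) * (r - pospart (r - eps)) +
  cutoff r * (m.+1%:R * wratio r ^+ m * dwratio r / r ^+ m.+1).
  rewrite /profile /dprofile /cutoff !addnS addn0 !exprS.
  move: (wratio r) (dwratio r) (pospart _) => w dw' z.
  by field; rewrite expf_neq0// gt_eqF.
have -> : m.+1%:R * ((beta + slope * r) ^+ m *
     (slope * r * ln (R / r) + (beta + slope * r))) / (r * ln (R / r)) ^+ m.+2 =
     m.+1%:R * wratio r ^+ m * dwratio r / r ^+ m.+1.
  rewrite /wratio /dwratio exprMn expr_div_n !exprS.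
  by field; rewrite !expf_neq0 ?gt_eqF.
rewrite lerDr; apply: mulr_ge0; last by rewrite subr_ge0.
apply: divr_ge0; last by rewrite exprn_ge0// ltW.
by apply: mulr_ge0; [apply: mulr_ge0 => //|]; rewrite exprn_ge0.
Qed.
End profile.

(** * The Euclidean norm and derivatives along lines *)

Section euclidean.
Variable K : realType.
Implicit Types n : nat.

Lemma enorm_ge0 n (x : 'rV[K]_n) : 0 <= enorm x.
Proof. exact: sqrtr_ge0. Qed.

Lemma sum_sqr_ge0 n (x : 'rV[K]_n) : 0 <= \sum_(i < n) x ord0 i ^+ 2.
Proof. by apply: sumr_ge0 => i _; exact: sqr_ge0. Qed.

Lemma sqr_enorm n (x : 'rV[K]_n) : enorm x ^+ 2 = \sum_(i < n) x ord0 i ^+ 2.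
Proof. by rewrite sqr_sqrtr// sum_sqr_ge0. Qed.

Lemma enorm0 n : enorm (0 : 'rV[K]_n) = 0.
Proof.
rewrite /enorm big1 ?sqrtr0// => i _.
by rewrite mxE expr0n.
Qed.

Lemma coord_le_enorm n (x : 'rV[K]_n) i : `|x ord0 i| <= enorm x.
Proof.
rewrite -sqrtr_sqr ler_sqrt ?sum_sqr_ge0// (bigD1 i)//= lerDl.
by apply: sumr_ge0 => j _; exact: sqr_ge0.
Qed.

Lemma norm_le_enorm n (x : 'rV[K]_n) : `|x| <= enorm x.
Proof. by apply: norm_leP; [exact: enorm_ge0|exact: coord_le_enorm]. Qed.

Lemma enorm_cauchy n (x y : 'rV[K]_n) :
  \sum_(i < n) x ord0 i * y ord0 i <= enorm x * enorm y.
Proof.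
have [x0|x0] := eqVneq (enorm x) 0.
  rewrite x0 mul0r big1// => i _; have := coord_le_enorm x i.
  by rewrite x0 normr_le0 => /eqP ->; rewrite mul0r.
have [y0|y0] := eqVneq (enorm y) 0.
  rewrite y0 mulr0 big1// => i _; have := coord_le_enorm y i.
  by rewrite y0 normr_le0 => /eqP ->; rewrite mulr0.
have px : 0 < enorm x by rewrite lt0r x0 enorm_ge0.
have py : 0 < enorm y by rewrite lt0r y0 enorm_ge0.
apply: (@le_trans _ _ (\sum_(i < n) 2^-1 * (enorm y / enorm x * x ord0 i ^+ 2 +
   enorm x / enorm y * y ord0 i ^+ 2))).
  apply: ler_sum => i _; rewrite -subr_ge0.
  have -> : 2^-1 * (enorm y / enorm x * x ord0 i ^+ 2 +
      enorm x / enorm y * y ord0 i ^+ 2) - x ord0 i * y ord0 i =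
     2^-1 * (enorm x * enorm y)^-1 * (enorm y * x ord0 i - enorm x * y ord0 i) ^+ 2.
    by field; rewrite ?x0 ?y0.
  by rewrite mulr_ge0 ?sqr_ge0// mulr_ge0// invr_ge0// mulr_ge0 ?enorm_ge0.
rewrite -mulr_sumr big_split/= -!mulr_sumr -!sqr_enorm le_eqVlt; apply/orP; left.
by apply/eqP; field; rewrite x0 y0.
Qed.

Lemma enorm_triangle n (x y : 'rV[K]_n) : enorm (x + y) <= enorm x + enorm y.
Proof.
rewrite -(@ler_pXn2r _ 2)// ?nnegrE ?addr_ge0 ?enorm_ge0//.
have -> : enorm (x + y) ^+ 2 = enorm x ^+ 2 + enorm y ^+ 2 +
    2 * \sum_(i < n) x ord0 i * y ord0 i.
  rewrite !sqr_enorm mulr_sumr -!big_split /=; apply: eq_bigr => i _.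
  by rewrite mxE; ring.
by have := enorm_cauchy x y; rewrite sqrrD; lra.
Qed.

Lemma enormN n (x : 'rV[K]_n) : enorm (- x) = enorm x.
Proof. by rewrite /enorm; congr Num.sqrt; apply: eq_bigr => i _; rewrite mxE sqrrN. Qed.

Lemma enorm_le_norm n (x : 'rV[K]_n) : enorm x <= n%:R * `|x|.
Proof.
rewrite -(@ler_pXn2r _ 2)// ?nnegrE ?mulr_ge0 ?enorm_ge0//.
rewrite sqr_enorm; apply: (@le_trans _ _ (\sum_(i < n) `|x| ^+ 2)).
  apply: ler_sum => i _; rewrite -real_normK ?num_real// lerXn2r// ?nnegrE//.
  exact: coord_le_norm.
rewrite sumr_const card_ord exprMn -[leLHS]mulr_natl ler_wpM2r ?sqr_ge0//.
by case: (n) => [|k]; rewrite ?expr0n// expr2 ler_peMl// ler1n.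
Qed.

Lemma continuous_sum_fun (T : topologicalType) n (f : 'I_n -> T -> K) (x : T) :
  (forall i, {for x, continuous (f i)}) ->
  {for x, continuous (fun y => \sum_(i < n) f i y)}.
Proof.
elim: n f => [|n IH] f cf.
  have -> : (fun y => \sum_(i < 0) f i y) = (fun=> 0) by apply/funext => y; rewrite big_ord0.
  exact: continuous_cst.
have -> : (fun y => \sum_(i < n.+1) f i y) =
    (fun y => f ord0 y + \sum_(i < n) f (lift ord0 i) y).
  by apply/funext => y; rewrite big_ord_recl.
by apply: continuous_add => //; apply: IH.
Qed.

Lemma continuous_coord n (i : 'I_n) (x : 'rV[K]_n) :
  {for x, continuous (fun y : 'rV[K]_n => y ord0 i)}.
Proof. exact: coord_continuous. Qed.

Lemma continuous_enorm_row (T : topologicalType) n (g : 'I_n -> T -> K) (x : T) :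
  (forall i, {for x, continuous (g i)}) ->
  {for x, continuous (fun y => enorm (\row_i g i y))}.
Proof.
move=> cg; have -> : (fun y => enorm (\row_i g i y)) =
    (fun y => Num.sqrt (\sum_(i < n) g i y ^+ 2)).
  by apply/funext => y; rewrite /enorm; congr Num.sqrt; apply: eq_bigr => i _; rewrite mxE.
apply: (@continuous_comp_fun K T (fun y => \sum_(i < n) g i y ^+ 2) Num.sqrt).
  by apply: continuous_sum_fun => i; exact: continuous_pow.
exact: sqrt_continuous.
Qed.

Lemma enorm_continuous n : continuous (@enorm K n).
Proof.
move=> x; have -> : @enorm K n = (fun y => enorm (\row_i y ord0 i)).
  by apply/funext => y; congr enorm; apply/rowP => i; rewrite mxE.
by apply: continuous_enorm_row => i; exact: continuous_coord.
Qed.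

Lemma line_continuous n (x e : 'rV[K]_n) : continuous (fun h : K => x + h *: e).
Proof.
by move=> h; apply: cvgD; [exact: cvg_cst|apply: cvgZl; exact: cvg_id].
Qed.

Lemma is_derive_enorm_line n (x : 'rV[K]_n) i : 0 < enorm x ->
  is_derive (0 : K) 1 (fun h => enorm (x + h *: delta_mx ord0 i)) (x ord0 i / enorm x).
Proof.
move=> x0.
have lineE h : \sum_(j < n) (x + h *: delta_mx ord0 i) ord0 j ^+ 2 =
    enorm x ^+ 2 + h * (2 * x ord0 i + h).
  rewrite sqr_enorm (bigD1 i)//= [in RHS](bigD1 i)//= !mxE !eqxx /=.
  have -> : \sum_(j < n | j != i) (x + h *: delta_mx ord0 i) ord0 j ^+ 2 =
      \sum_(j < n | j != i) x ord0 j ^+ 2.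
    by apply: eq_bigr => j ji; rewrite !mxE (negPf ji) andbF mulr0 addr0.
  by ring.
have -> : (fun h => enorm (x + h *: delta_mx ord0 i)) =
    (fun h => Num.sqrt (enorm x ^+ 2 + h * (2 * x ord0 i + h))).
  by apply/funext => h; rewrite /enorm lineE.
have dp := is_derive_add (is_derive_const (enorm x ^+ 2) 0)
  (is_derive_mul (is_derive_var 0) (is_derive_add (is_derive_const (2 * x ord0 i) 0)
    (is_derive_var 0))).
have s0 : 0 < enorm x ^+ 2 + 0 * (2 * x ord0 i + 0) by rewrite mul0r addr0 exprn_gt0.
have d := @is_derive_comp_fun K Num.sqrt
   (fun h => enorm x ^+ 2 + h * (2 * x ord0 i + h)) 0 _ _ (is_derive1_sqrt s0) dp.
apply: (is_derive_eq d); rewrite mul0r addr0 sqrtr_sqr ger0_norm ?enorm_ge0//.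
by field; rewrite gt_eqF.
Qed.

Lemma is_derive_line n (phi : 'rV[K]_n -> K) (x e : 'rV[K]_n) :
  derivable phi x e ->
  is_derive (0 : K) 1 (fun h => phi (x + h *: e)) ('D_e phi x).
Proof.
move=> dphi.
have E : (fun h : K => h^-1 *: (((fun h => phi (x + h *: e)) \o shift 0) (h *: 1) -
    (fun h => phi (x + h *: e)) 0)) =
  (fun h : K => h^-1 *: ((phi \o shift x) (h *: e) - phi x)).
  apply/funext => h /=; rewrite scale0r !addr0 [x + _]addrC.
  by rewrite /GRing.scale/= mulr1.
by split; rewrite /derivable /derive E.
Qed.

Lemma continuous_near (T : topologicalType) (f g : T -> K) (x : T) :
  (\forall y \near x, f y = g y) -> {for x, continuous f} -> {for x, continuous g}.
Proof.
move=> fg cf; have fgx := nbhs_singleton fg.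
rewrite /prop_for /continuous_at -fgx.
exact: cvg_trans (near_eq_cvg fg) cf.
Qed.

End euclidean.

(** * A radial field multiplied by a power of a test function *)

Section test_functions.
Variables (K : realType) (m : nat).
Local Notation n := m.+2.
Local Notation mu := (lebesgue_rV K n).
Implicit Types (x : 'rV[K]_n) (phi : 'rV[K]_n -> K) (Omega : set 'rV[K]_n).

Lemma test_function_continuous Omega phi : test_function Omega phi -> continuous phi.
Proof. by case=> sphi _ _; have [] := sphi [::]. Qed.

Lemma test_function_partial_continuous Omega phi i :
  test_function Omega phi -> continuous (partial i phi).
Proof. by case=> sphi _ _; have [] := sphi [:: i]. Qed.

Lemma test_function_derivable Omega phi i x :
  test_function Omega phi -> derivable phi x (delta_mx ord0 i).
Proof. by case=> sphi _ _; have [_] := sphi [::]; apply. Qed.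

Lemma test_function_eq0 Omega phi x : test_function Omega phi -> ~ Omega x -> phi x = 0.
Proof.
case=> _ _ suppO nOx; apply/eqP/negPn/negP => phix.
by apply: nOx; apply: suppO; exact: subset_closure.
Qed.

Lemma gradient_continuous Omega phi : test_function Omega phi ->
  continuous (fun x => enorm (gradient phi x)).
Proof.
move=> tphi x; apply: continuous_enorm_row => i.
exact: (test_function_partial_continuous tphi).
Qed.

Variables (Omega : set 'rV[K]_n) (phi : 'rV[K]_n -> K) (R Rt eps : K) (A A' : K -> K).
Hypotheses (OmegaRt : forall x, Omega x -> enorm x <= Rt) (RtR : Rt < R) (eps0 : 0 < eps).
Hypothesis tphi : test_function Omega phi.
Hypothesis dA : forall r, 0 < r < R -> is_derive r 1 A (A' r).
Hypothesis cA' : forall r, 0 < r < R -> {for r, continuous A'}.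
Hypotheses (A0 : forall r, r <= eps -> A r = 0) (A'0 : forall r, r <= eps -> A' r = 0).

Let phi0 x : Rt < enorm x -> phi x = 0.
Proof.
by move=> xRt; apply: (test_function_eq0 tphi) => /OmegaRt; rewrite leNgt xRt.
Qed.

(** The field is A(|x|) |phi|^N x; [field_coord], [field_deriv] and [field_div]
    are its components, their partial derivatives and its divergence. *)
Definition field_coord (i : 'I_n) (x : 'rV[K]_n) : K :=
  x ord0 i * A (enorm x) * `|phi x| ^+ n.

Definition field_deriv (i : 'I_n) (x : 'rV[K]_n) : K :=
  (A (enorm x) + x ord0 i * (A' (enorm x) * (x ord0 i / enorm x))) * `|phi x| ^+ n +
  x ord0 i * A (enorm x) * (n%:R * (`|phi x| ^+ m * phi x) * partial i phi x).

Definition field_div (x : 'rV[K]_n) : K :=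
  (n%:R * A (enorm x) + enorm x * A' (enorm x)) * `|phi x| ^+ n +
  A (enorm x) * (n%:R * (`|phi x| ^+ m * phi x) *
    \sum_(i < n) x ord0 i * partial i phi x).

Lemma sum_field_deriv x : \sum_(i < n) field_deriv i x = field_div x.
Proof.
rewrite big_split /= -mulr_suml big_split /= sumr_const card_ord.
rewrite /field_div [n%:R * A _]mulr_natl; congr ((_ + _) * _ + _).
  transitivity (A' (enorm x) / enorm x * \sum_(i < n) x ord0 i ^+ 2).
    by rewrite mulr_sumr; apply: eq_bigr => i _; ring.
  rewrite -sqr_enorm expr2 mulrA; have [->|x0] := eqVneq (enorm x) 0.
    by rewrite mulr0 mul0r.
  by rewrite divfK// mulrC.
by rewrite !mulr_sumr; apply: eq_bigr => i _; ring.
Qed.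

(** In the first two cases the field vanishes near x, because A or phi does, so
    neither the singularity at the origin nor the sphere of radius R is seen;
    in the third one the product and chain rules apply. *)
Lemma radius_cases (x : 'rV[K]_n) :
  [\/ enorm x < eps, Rt < enorm x | 0 < enorm x < R].
Proof.
have [xe|ex] := ltP (enorm x) eps; first exact: Or31.
have [xR|Rx] := ltP Rt (enorm x); first exact: Or32.
by apply: Or33; rewrite (lt_le_trans eps0)//= (le_lt_trans Rx).
Qed.

Lemma field_deriv_eq0 i (x : 'rV[K]_n) : enorm x < eps \/ Rt < enorm x -> field_deriv i x = 0.
Proof.
rewrite /field_deriv => -[xe|xR].
  by rewrite A0 ?A'0 ?ltW// !(mulr0, mul0r, addr0).
by rewrite phi0// normr0 !expr0n /= !(mulr0, mul0r, addr0).
Qed.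

Lemma field_coord_eq0 i (x : 'rV[K]_n) : enorm x < eps \/ Rt < enorm x -> field_coord i x = 0.
Proof.
rewrite /field_coord => -[xe|xR].
  by rewrite A0 ?ltW// !(mulr0, mul0r, addr0).
by rewrite phi0// normr0 !expr0n /= !(mulr0, mul0r, addr0).
Qed.

Lemma field_deriv_continuous i : continuous (field_deriv i).
Proof.
move=> x; have cphi := @test_function_continuous _ _ tphi.
have near0 : (\forall y \near x, enorm y < eps \/ Rt < enorm y) ->
    {for x, continuous (field_deriv i)}.
  move=> nx; apply: (@continuous_near K _ (fun=> 0)); last exact: continuous_cst.
  by apply: filterS nx => y /field_deriv_eq0 ->.
have [xe|xR|xR] := radius_cases x.
- apply: near0; have h : \forall y \near x, enorm y < eps.
    exact: cvgr_lt _ (@enorm_continuous K n x) _ xe.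
  by apply: filterS h => y; left.
- apply: near0; have h : \forall y \near x, Rt < enorm y.
    exact: cvgr_gt _ (@enorm_continuous K n x) _ xR.
  by apply: filterS h => y; right.
have /andP[x0 _] := xR.
have cn : {for x, continuous (@enorm K n)} by exact: enorm_continuous.
have cx := @continuous_coord K n i x.
have cA : {for x, continuous (fun x => A (enorm x))}.
  apply: continuous_comp_fun => //; apply/differentiable_continuous/derivable1_diffP.
  by have [] := dA xR.
have cB : {for x, continuous (fun x => A' (enorm x))}.
  by apply: continuous_comp_fun => //; exact: cA'.
have cabs : {for x, continuous (fun x => `|phi x|)} by apply: continuous_abs; exact: cphi.
change {for x, continuous (field_deriv i)}; rewrite /field_deriv.
apply: continuous_add.
  apply: continuous_mul; last exact: continuous_pow.
  apply: continuous_add => //; apply: continuous_mul => //.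
  apply: continuous_mul => //; apply: continuous_mul => //.
  by apply: continuous_inv => //; rewrite gt_eqF.
apply: continuous_mul; first exact: continuous_mul.
apply: continuous_mul; last exact: (test_function_partial_continuous tphi).
apply: continuous_mul; first exact: continuous_cst.
by apply: continuous_mul; [exact: continuous_pow|exact: cphi].
Qed.

Lemma is_derive_field_coord i x :
  is_derive (0 : K) 1 (fun h => field_coord i (x + h *: delta_mx ord0 i)) (field_deriv i x).
Proof.
set e := delta_mx ord0 i.
have line0 : x + 0 *: e = x by rewrite scale0r addr0.
have near0 : (\forall h \near (0 : K), enorm (x + h *: e) < eps \/ Rt < enorm (x + h *: e)) ->
    is_derive (0 : K) 1 (fun h => field_coord i (x + h *: e)) (field_deriv i x).
  move=> nx; have := nbhs_singleton nx; rewrite line0 => /(field_deriv_eq0 i) dx.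
  have E : \forall h \near (0 : K), 0 = field_coord i (x + h *: e).
    by apply: filterS nx => h /(field_coord_eq0 i) ->.
  rewrite dx; exact: (near_eq_is_derive E (is_derive_const 0 0)).
have cline : {for (0 : K), continuous (fun h : K => enorm (x + h *: e))}.
  apply: (@continuous_comp K 'rV[K]_n K (fun h : K => x + h *: e) (@enorm K n)).
    exact: line_continuous.
  exact: enorm_continuous.
have [xe|xR|xR] := radius_cases x.
- apply: near0; have : enorm (x + 0 *: e) < eps by rewrite line0.
  by move=> /(cvgr_lt _ cline) h; apply: filterS h => y; left.
- apply: near0; have : Rt < enorm (x + 0 *: e) by rewrite line0.
  by move=> /(cvgr_gt _ cline) h; apply: filterS h => y; right.
have /andP[x0 _] := xR.
have d1 : is_derive (0 : K) 1 (fun h => (x + h *: e) ord0 i) 1.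
  have -> : (fun h : K => (x + h *: e) ord0 i) = (fun h => x ord0 i + h).
    by apply/funext => h; rewrite !mxE !eqxx mulr1.
  by apply: (is_derive_eq (is_derive_add (is_derive_const _ 0) (is_derive_var 0))); rewrite add0r.
have dA0 : is_derive (enorm (x + 0 *: e)) 1 A (A' (enorm x)) by rewrite line0; exact: dA.
have d2 := @is_derive_comp_fun K A (fun h => enorm (x + h *: e)) 0 _ _ dA0
  (is_derive_enorm_line i x0).
have d3 := @is_derive_comp_fun K (fun y => `|y| ^+ n) (fun h => phi (x + h *: e)) 0 _ _
  (is_derive_norm_exp m _) (is_derive_line (@test_function_derivable _ _ i x tphi)).
apply: (is_derive_eq (is_derive_mul (is_derive_mul d1 d2) d3)).
rewrite line0 /field_deriv /partial -/e.
by ring.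
Qed.

Lemma field_div_integrable : mu.-integrable setT (EFin \o field_div).
Proof.
have cdiv : continuous field_div.
  have -> : field_div = (fun x => \sum_(i < n) field_deriv i x).
    by apply/funext => x; rewrite sum_field_deriv.
  by move=> x; apply: continuous_sum_fun => i; exact: field_deriv_continuous.
have div0 x : Rt < `|x| -> field_div x = 0.
  move=> xRt; rewrite -sum_field_deriv big1// => i _; apply: field_deriv_eq0.
  by right; exact: lt_le_trans xRt (norm_le_enorm x).
have [B _ fB] := continuous_bounded Rt cdiv.
apply: (@box_integrable _ _ _ Rt (Num.max B 0)) => //; first exact: continuous_measurable_rV.
move=> x; have [xM|Mx] := leP `|x| Rt; first by rewrite le_max fB.
by rewrite div0// normr0 le_max lexx orbT.
Qed.

Lemma field_deriv_integrable i : mu.-integrable setT (EFin \o field_deriv i).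
Proof.
have d0 x : Rt < `|x| -> field_deriv i x = 0.
  move=> xRt; apply: field_deriv_eq0.
  by right; exact: lt_le_trans xRt (norm_le_enorm x).
have [B _ fB] := continuous_bounded Rt (@field_deriv_continuous i).
apply: (@box_integrable _ _ _ Rt (Num.max B 0)) => //.
  by apply: continuous_measurable_rV; exact: field_deriv_continuous.
move=> x; have [xM|Mx] := leP `|x| Rt; first by rewrite le_max fB.
by rewrite d0// normr0 le_max lexx orbT.
Qed.

Lemma integral_field_div_eq0 : (\int[mu]_x (field_div x)%:E = 0)%E.
Proof.
under eq_integral do rewrite -sum_field_deriv -sumEFin.
rewrite integral_sum//; last by move=> i; exact: field_deriv_integrable.
rewrite big1// => i _; apply: (@integral_partial_eq0 K n i _ (field_coord i) Rt).
- exact: field_deriv_continuous.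
- exact: is_derive_field_coord.
- move=> x xRt; apply: field_coord_eq0.
  by right; exact: lt_le_trans xRt (norm_le_enorm x).
- move=> x xRt; apply: field_deriv_eq0.
  by right; exact: lt_le_trans xRt (norm_le_enorm x).
Qed.
End test_functions.

(** * The improved Hardy inequality for test functions *)

Section hardy_test.
Variables (K : realType) (m : nat).
Local Notation n := m.+2.
Local Notation mu := (lebesgue_rV K n).

Lemma measurable_comp_fun d (T : measurableType d) (D : set T) (f : K -> K) (g : T -> K) :
  measurable_fun setT f -> measurable_fun D g -> measurable_fun D (fun x => f (g x)).
Proof. exact: measurableT_comp. Qed.

(** The total inverse, with value 0 at 0, is x times a real power of x^2. *)
Lemma measurable_inv : measurable_fun setT (fun x : K => x^-1).
Proof.
have -> : (fun x : K => x^-1) = (fun x => x * (x ^+ 2) `^ (-1)).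
  apply/funext => x; rewrite powR_inv1 ?sqr_ge0// expr2.
  by have [->|x0] := eqVneq x 0; [rewrite invr0 mul0r|field].
apply: measurable_funM => //.
apply: (measurable_comp_fun (f := fun y : K => y `^ (-1))); first exact: measurable_powR.
exact: measurable_funX.
Qed.

Lemma measurable_enorm k : measurable_fun setT (@enorm K k).
Proof. by apply: continuous_measurable_rV; exact: enorm_continuous. Qed.

Variables (R Rt b : K).
Let beta : K := m.+1%:R / n%:R.
Let kappa : K := beta ^+ n.
(* hardy_gain is the constant of the zero-order remainder, hardy_potential the
   potential of the critical Hardy inequality with its sharp constant. *)
Definition hardy_gain : K := ((m.+1%:R / n%:R) ^+ n) * b / (2 * R ^+ m.+1).
Definition hardy_potential (r : K) : K :=
  ((m.+1%:R / n%:R) ^+ n) / (r ^+ n * ln (R / r) ^+ n).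
Definition cut_weight (eps r : K) : K :=
  cutoff eps r * (hardy_potential r + hardy_gain).

Hypotheses (R0 : 0 < R) (RtR : Rt < R) (b0 : 0 < b) (bR1 : n%:R * (b * R) <= 1).
Hypothesis bR2 : 2 * n%:R ^+ 2 * (b * R) <= kappa * (1 - Rt / R).

Let kappa0 : 0 < kappa.
Proof. by rewrite exprn_gt0// divr_gt0// ltr0n. Qed.

Lemma hardy_gain_gt0 : 0 < hardy_gain.
Proof. by rewrite divr_gt0// mulr_gt0// exprn_gt0. Qed.

Lemma hardy_potential_ge0 r : 0 <= r < R -> 0 <= hardy_potential r.
Proof.
move=> /andP[r0 rR]; rewrite divr_ge0 ?(ltW kappa0)// mulr_ge0 ?exprn_ge0//.
have [->|rn0] := eqVneq r 0; first by rewrite invr0 mulr0 ln0.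
by rewrite ltW// ln_ratio_gt0// lt0r rn0 r0.
Qed.

Lemma cutoff_ge0 (eps r : K) : 0 <= r -> 0 <= cutoff eps r.
Proof.
move=> r0; rewrite divr_ge0 ?exprn_ge0// pospartE.
by rewrite le_max lexx orbT.
Qed.

Lemma cut_weight_ge0 eps r : 0 <= r < R -> 0 <= cut_weight eps r.
Proof.
move=> rR; have /andP[r0 _] := rR.
by rewrite mulr_ge0 ?cutoff_ge0// addr_ge0 ?hardy_potential_ge0// ltW// hardy_gain_gt0.
Qed.

Lemma measurable_hardy_potential :
  measurable_fun setT (fun x : 'rV[K]_n => hardy_potential (enorm x)).
Proof.
apply: measurable_funM => //; apply: (measurable_comp_fun measurable_inv).
have mE := @measurable_enorm n.
apply: measurable_funM; apply: measurable_funX => //.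
apply: (measurable_comp_fun (@measurable_ln K)); apply: measurable_funM => //.
exact: (measurable_comp_fun measurable_inv).
Qed.

Lemma measurable_cut_weight eps :
  measurable_fun setT (fun x : 'rV[K]_n => cut_weight eps (enorm x)).
Proof.
have mE := @measurable_enorm n.
apply: measurable_funM; last first.
  by apply: measurable_funD => //; exact: measurable_hardy_potential.
apply: measurable_funM; last first.
  by apply: (measurable_comp_fun measurable_inv); exact: measurable_funX.
apply: measurable_funX; apply: (measurable_comp_fun (_ : measurable_fun setT (@pospart K))).
  by apply: measurable_realfun.continuous_measurable_fun; exact: pospart_continuous.
exact: measurable_funB.
Qed.

Variables (Omega : set 'rV[K]_n).
Hypotheses (oOmega : open Omega) (OmegaRt : forall x, Omega x -> enorm x <= Rt).

Lemma Omega_lt_top : (mu Omega < +oo)%E.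
Proof.
apply: le_lt_trans (ltry ((2 * Num.max Rt 0) ^+ n)).
apply: lebesgue_box_le; first by rewrite le_max lexx orbT.
  exact: open_measurable_rV.
move=> x /OmegaRt xR i; apply: le_trans (coord_le_enorm _ _) _.
by rewrite le_max xR.
Qed.

Lemma Omega_continuous_integrable (f : 'rV[K]_n -> K) : continuous f ->
  mu.-integrable Omega (EFin \o f).
Proof.
move=> cf; apply: measurable_bounded_integrable.
- exact: open_measurable_rV.
- exact: Omega_lt_top.
- by apply: measurable_funTS; exact: continuous_measurable_rV.
have [B _ fB] := continuous_bounded Rt cf.
exists B; split; first exact: num_real.
move=> C BC x /OmegaRt xRt; apply: le_trans (ltW BC); apply: fB.
exact: le_trans (norm_le_enorm x) xRt.
Qed.

(** The pointwise form of the vector-field method: the term of the divergence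
    that contains the gradient of phi is absorbed by |grad phi|^N through
    Young's inequality, and what is left of the divergence dominates the
    potential by the radial inequality. *)
Lemma hardy_pointwise eps (phi : 'rV[K]_n -> K) x : 0 < eps -> test_function Omega phi ->
  cut_weight eps (enorm x) * `|phi x| ^+ n <=
  field_div phi (profile m R beta b eps) (dprofile m R beta b eps) x +
  enorm (gradient phi x) ^+ n.
Proof.
move=> e0 tphi.
have [phi0|phin0] := eqVneq (phi x) 0.
  rewrite /field_div phi0 normr0 expr0n /= !(mulr0, mul0r, addr0, add0r).
  by rewrite exprn_ge0// enorm_ge0.
have Ox : Omega x.
  by apply: contrapT => /(test_function_eq0 tphi) /eqP; rewrite (negPf phin0).
have rRt := OmegaRt Ox.
have [r0|rn0] := eqVneq (enorm x) 0.
  rewrite /field_div r0 !profile_eq0 ?dprofile_eq0 ?(ltW e0)//.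
  rewrite /cut_weight /cutoff expr0n /= invr0 !(mulr0, mul0r, addr0, add0r).
  by rewrite exprn_ge0// enorm_ge0.
have r0 : 0 < enorm x by rewrite lt0r rn0 enorm_ge0.
have rR : 0 < enorm x < R by rewrite r0 (le_lt_trans rRt).
have t0 := ln_ratio_gt0 rR.
have := @radial_ineq K m R Rt b (enorm x).
rewrite /= r0 rRt => /(_ isT RtR b0 bR1 bR2) hrad.
have beta0 : 0 < beta by rewrite divr_gt0// ltr0n.
have q0 : 0 < beta + b * enorm x by rewrite addr_gt0// mulr_gt0.
have hdiv := @div_profile_ge K m R beta b eps _ rR (ltW e0) (ltW q0).
have hprof := @profileE K m R beta b eps _ rR.
have /andP[chi0 chi1] := cutoff01 r0 (ltW e0).
have A0 : 0 <= profile m R beta b eps (enorm x).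
  rewrite -(pmulr_lge0 _ r0) hprof mulr_ge0// exprn_ge0// divr_ge0 ?(ltW q0)//.
  by rewrite mulr_ge0 ?(ltW r0) ?(ltW t0).
set r := enorm x in r0 rn0 rR rRt t0 hrad q0 hdiv hprof chi0 chi1 A0 *.
set t := ln (R / r) in t0 hrad hdiv hprof *.
set q := beta + b * r in q0 hrad hdiv hprof *.
set A := profile _ _ _ _ _ _ in A0 hprof hdiv *.
set X := `|phi x|; have X0 : 0 <= X by exact: normr_ge0.
set a := enorm (gradient phi x); have a0 : 0 <= a by exact: enorm_ge0.
set S := \sum_(i < n) x ord0 i * partial i phi x.
have SE : S = \sum_(i < n) x ord0 i * gradient phi x ord0 i.
  by apply: eq_bigr => i _; rewrite mxE.
have hS : `|S| <= r * a.
  rewrite ler_norml SE enorm_cauchy andbT lerNl -sumrN /r -(enormN x).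
  rewrite (le_trans _ (enorm_cauchy (- x) (gradient phi x)))//.
  by apply: ler_sum => i _; rewrite [(- x) _ _]mxE mulNr.
set c := X * (q / (r * t)).
have c0 : 0 <= c by rewrite mulr_ge0// divr_ge0 ?(ltW q0)// mulr_ge0 ?(ltW r0) ?(ltW t0).
set chi := cutoff eps r in hdiv hprof chi0 chi1 *.
(* c is chosen so that A r X^(N-1) = chi c^(N-1), which puts Young in the form
   N a c^(N-1) <= a^N + (N-1) c^N. *)
have hflux : - (a ^+ n + chi * (m.+1%:R * c ^+ n)) <=
    A * (n%:R * (X ^+ m * phi x) * S).
  have hy := @young_ineq K m.+1 a c a0 c0.
  have h1 : `|A * (n%:R * (X ^+ m * phi x) * S)| <= chi * (n%:R * a * c ^+ m.+1).
    have -> : chi * (n%:R * a * c ^+ m.+1) = A * (n%:R * (X ^+ m * X) * (r * a)).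
      have -> : A * (n%:R * (X ^+ m * X) * (r * a)) = (A * r) * (n%:R * X ^+ m.+1 * a).
        by rewrite exprS; ring.
      by rewrite hprof /c exprMn; ring.
    rewrite normrM (ger0_norm A0); apply: ler_wpM2l => //.
    have -> : `|n%:R * (X ^+ m * phi x) * S| = n%:R * (X ^+ m * X) * `|S|.
      by rewrite normrM [`|n%:R * _|]normrM normr_nat normrM (ger0_norm (exprn_ge0 _ X0)).
    apply: ler_wpM2l => //.
    by rewrite mulr_ge0// mulr_ge0// exprn_ge0.
  have h2 : chi * (n%:R * a * c ^+ m.+1) <= a ^+ n + chi * (m.+1%:R * c ^+ n).
    apply: (le_trans (ler_wpM2l chi0 hy)); rewrite mulrDr lerD2r.
    by rewrite ler_piMl// exprn_ge0.
  by rewrite lerNl; apply: le_trans h2; apply: le_trans h1; rewrite -normrN ler_norm.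
have rtn : 0 < (r * t) ^+ n by rewrite exprn_gt0// mulr_gt0.
have key : cut_weight eps r * X ^+ n <=
    (n%:R * A + r * dprofile m R beta b eps r) * X ^+ n - chi * (m.+1%:R * c ^+ n).
  have -> : chi * (m.+1%:R * c ^+ n) = chi * (m.+1%:R * q ^+ n / (r * t) ^+ n) * X ^+ n.
    by rewrite /c exprMn expr_div_n; ring.
  rewrite -mulrBl ler_wpM2r ?exprn_ge0//.
  apply: le_trans (lerB hdiv (lexx _)); rewrite -mulrBr ler_wpM2l//.
  rewrite -mulrBl ler_pdivlMr// /hardy_potential /hardy_gain -/r -/t.
  rewrite -mulrBr; apply: le_trans hrad; rewrite -exprMn le_eqVlt; apply/orP; left.
  apply/eqP; rewrite mulrDl divfK ?gt_eqF//.
rewrite /field_div -/r -/t -/A -/X -/S.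
by move: key hflux; lra.
Qed.

Lemma hardy_test_function eps (phi : 'rV[K]_n -> K) : 0 < eps -> test_function Omega phi ->
  (\int[mu]_(x in Omega) (cut_weight eps (enorm x) * `|phi x| ^+ n)%:E <=
   \int[mu]_(x in Omega) (enorm (gradient phi x) ^+ n)%:E)%E.
Proof.
move=> e0 tphi.
pose f := field_div phi (profile m R beta b eps) (dprofile m R beta b eps).
have mO : measurable Omega by exact: open_measurable_rV.
have intf : mu.-integrable setT (EFin \o f).
  apply: (field_div_integrable OmegaRt RtR e0 tphi).
  - by move=> r; exact: is_derive_profile.
  - by move=> r; exact: dprofile_continuous.
  - by move=> r; exact: profile_eq0.
  - by move=> r; exact: dprofile_eq0.
have If : (\int[mu]_(x in Omega) (f x)%:E = 0)%E.
  have <- : (\int[mu]_x (f x)%:E = 0)%E.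
    apply: (integral_field_div_eq0 OmegaRt RtR e0 tphi).
    - by move=> r; exact: is_derive_profile.
    - by move=> r; exact: dprofile_continuous.
    - by move=> r; exact: profile_eq0.
    - by move=> r; exact: dprofile_eq0.
  rewrite integral_mkcond; apply: eq_integral => x _; rewrite patchE.
  case: ifPn => //; rewrite notin_setE => /(test_function_eq0 tphi) px.
  by rewrite /f /field_div px normr0 expr0n /= !(mulr0, mul0r, addr0).
have cg : continuous (fun x => enorm (gradient phi x) ^+ n).
  move=> x; apply: (@continuous_pow K _ (fun x => enorm (gradient phi x)) n x).
  exact: (gradient_continuous tphi).
have intg := Omega_continuous_integrable cg.
have intfO : mu.-integrable Omega (EFin \o f) by apply: integrableS intf.
pose g (x : 'rV[K]_n) : K := enorm (gradient phi x) ^+ n.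
apply: (@le_trans _ _ (\int[mu]_(x in Omega) ((EFin \o f) x + (EFin \o g) x)%E)%E); last first.
  by rewrite integralD// [X in (X + _)%E]If add0e.
apply: ge0_le_integral => //.
- move=> x /OmegaRt xRt; rewrite lee_fin mulr_ge0// ?exprn_ge0// cut_weight_ge0// enorm_ge0.
  exact: le_lt_trans RtR.
- apply/measurable_EFinP/measurable_funTS/measurable_funM.
    exact: measurable_cut_weight.
  apply: measurable_funX; apply: measurableT_comp => //.
  by apply: continuous_measurable_rV; exact: (test_function_continuous tphi).
- by apply: emeasurable_funD; [case/integrableP: intfO|case/integrableP: intg].
- by move=> x _; rewrite -EFinD lee_fin; exact: hardy_pointwise.
Qed.
End hardy_test.

(** * Passage to the limit *)

Section limits.
Variable K : realType.

Lemma ge0_integral_comb d (T : measurableType d) (mu : {measure set T -> \bar K})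
    (D : set T) (f g h : T -> K) (a b : K) :
  measurable D -> measurable_fun D f -> measurable_fun D g -> measurable_fun D h ->
  0 <= a -> 0 <= b -> (forall x, D x -> 0 <= f x) -> (forall x, D x -> 0 <= g x) ->
  (forall x, D x -> 0 <= h x) -> (forall x, D x -> h x <= a * f x + b * g x) ->
  (\int[mu]_(x in D) (h x)%:E <=
   a%:E * \int[mu]_(x in D) (f x)%:E + b%:E * \int[mu]_(x in D) (g x)%:E)%E.
Proof.
move=> mD mf mg mh a0 b0 f0 g0 h0 hfg.
rewrite -!ge0_integralZl_EFin//; try by [exact/measurable_EFinP].
rewrite -ge0_integralD//.
- apply: ge0_le_integral => //; first exact/measurable_EFinP.
  by apply: emeasurable_funD; apply: emeasurable_funM => //; exact/measurable_EFinP.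
- by move=> x Dx; rewrite mule_ge0// lee_fin ?f0.
- by apply: emeasurable_funM => //; exact/measurable_EFinP.
- by move=> x Dx; rewrite mule_ge0// lee_fin ?g0.
- by apply: emeasurable_funM => //; exact/measurable_EFinP.
Qed.

Lemma bernoulli_exp (s : K) k : 0 <= s <= 1 -> 1 - k%:R * s <= (1 - s) ^+ k.
Proof.
move=> /andP[s0 s1]; elim: k => [|k IH]; first by rewrite expr0 mul0r subr0.
rewrite exprS; apply: (@le_trans _ _ ((1 - s) * (1 - k%:R * s))).
  rewrite -natr1 -subr_ge0 [leRHS](_ : _ = k%:R * s ^+ 2); last by ring.
  by rewrite mulr_ge0 ?sqr_ge0.
by rewrite ler_wpM2l// subr_ge0.
Qed.

(** First the approximation error e tends to 0 for fixed s, then the convexity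
    parameter s; the blow-up of B s as s tends to 0 is therefore harmless. *)
Lemma le_of_approx k (x y : K) (B : K -> K) : 0 <= x ->
  (forall s e : K, 0 < s < 1 -> 0 < e -> x <= (1 - s) ^- k * (y + B s * e)) -> x <= y.
Proof.
move=> x0 H.
have H1 s : 0 < s < 1 -> (1 - s) ^+ k * x <= y.
  move=> s01; have p : 0 < (1 - s) ^+ k by rewrite exprn_gt0// subr_gt0; case/andP: s01.
  apply/ler_addgt0Pr => e e0.
  have B0 : 0 < `|B s| + 1 by rewrite ltr_wpDl.
  have := H s (e / (`|B s| + 1)) s01 (divr_gt0 e0 B0).
  rewrite mulrC ler_pdivlMr// => h; rewrite mulrC; apply: le_trans h _.
  rewrite lerD2l mulrCA ler_piMr ?(ltW e0)// ler_pdivrMr// mul1r.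
  by rewrite (le_trans (ler_norm _))// lerDl.
apply/ler_addgt0Pr => e e0.
have q0 : 0 < k%:R * x + e + e by rewrite addr_gt0// ltr_wpDl// mulr_ge0.
pose s := e / (k%:R * x + e + e).
have s01 : 0 < s < 1.
  rewrite divr_gt0//= ltr_pdivrMr// mul1r.
  have : 0 <= k%:R * x by rewrite mulr_ge0.
  by lra.
have := H1 s s01.
have : (1 - k%:R * s) * x <= (1 - s) ^+ k * x.
  by rewrite ler_wpM2r// bernoulli_exp//; case/andP: s01 => /ltW -> /ltW ->.
have : k%:R * s * x <= e.
  have -> : k%:R * s * x = e * (k%:R * x / (k%:R * x + e + e)).
    by rewrite /s; field; rewrite gt_eqF.
  rewrite ler_piMr ?(ltW e0)// ler_pdivrMr// mul1r.
  by lra.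
by lra.
Qed.

End limits.

Section sobolev_limit.
Variables (K : realType) (m : nat).
Local Notation n := m.+2.
Local Notation mu := (lebesgue_rV K n).
Variables (Omega : set 'rV[K]_n) (u : 'rV[K]_n -> K) (g : 'rV[K]_n -> 'rV[K]_n).
Hypotheses (oOmega : open Omega) (ug : sobolev0 n Omega u g).

Let mO : measurable Omega. Proof. exact: open_measurable_rV. Qed.

Lemma sobolev0_approx (e : K) : 0 < e -> exists phi, [/\ test_function Omega phi,
  (\int[mu]_(x in Omega) (`|phi x - u x| ^+ n)%:E <= e%:E)%E &
  (\int[mu]_(x in Omega) (enorm (gradient phi x - g x) ^+ n)%:E <= e%:E)%E].
Proof.
move=> e0; have [_ _ [phi [tphi cphi]]] := ug.
pose d := e `^ n%:R^-1; have d0 : 0 < d by rewrite powR_gt0.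
have /cphi[k _ /(_ k (leqnn k)) /= hk] : nbhs (0%E : \bar K) [set y | (y < d%:E)%E].
  by apply: open_nbhs_nbhs; split; [exact: open_ereal_lt_ereal|rewrite /= lte_fin].
exists (phi k); set I1 := (\int[_]_(_ in _) _)%E; set I2 := (\int[_]_(_ in _) _)%E.
have I10 : (0 <= I1)%E by apply: integral_ge0 => x _; rewrite lee_fin exprn_ge0.
have I20 : (0 <= I2)%E.
  by apply: integral_ge0 => x _; rewrite lee_fin exprn_ge0// enorm_ge0.
have : (I1 + I2 < e%:E)%E.
  rewrite ltNge; apply/negP => h; move: hk; apply/negP; rewrite -leNgt.
  rewrite /sobolev_norm -/I1 -/I2.
  have -> : d%:E = (e%:E `^ n%:R^-1)%E by [].
  apply: gt0_ler_poweR => //; rewrite in_itv/= ?leey ?andbT ?lee_fin ?(ltW e0)//.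
  exact: adde_ge0.
move=> /ltW h; split => //; apply: le_trans h.
  by rewrite leeDl.
by rewrite leeDr.
Qed.

Lemma measurable_norm_exp (f : 'rV[K]_n -> K) : measurable_fun Omega f ->
  measurable_fun Omega (fun x => `|f x| ^+ n).
Proof. by move=> mf; apply: measurable_funX; exact: measurableT_comp. Qed.

Lemma measurable_enorm_coord d (T : measurableType d) (D : set T) (f : T -> 'rV[K]_n) :
  (forall i, measurable_fun D (fun x => f x ord0 i)) ->
  measurable_fun D (fun x => enorm (f x)).
Proof.
move=> mf; apply: (measurable_comp_fun (f := Num.sqrt)).
  by apply: measurable_realfun.continuous_measurable_fun; exact: sqrt_continuous.
by apply: measurable_sum => i; exact: measurable_funX.
Qed.

Lemma measurable_gradient_coord phi i : test_function Omega phi ->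
  measurable_fun Omega (fun x => gradient phi x ord0 i).
Proof.
move=> tphi; have -> : (fun x => gradient phi x ord0 i) = partial i phi.
  by apply/funext => x; rewrite mxE.
apply: measurable_funTS; apply: continuous_measurable_rV.
exact: (test_function_partial_continuous tphi).
Qed.

Lemma measurable_sobolev_gradient i : measurable_fun Omega (fun x => g x ord0 i).
Proof. by have [_ mg _] := ug; exact: measurableT_comp (measurable_rV_coord i) mg. Qed.

End sobolev_limit.

(** * The improved Hardy inequality in the Sobolev space *)

Section sobolev_hardy.
Variables (K : realType) (m : nat).
Local Notation n := m.+2.
Local Notation mu := (lebesgue_rV K n).
Variables (R Rt b : K).
Hypotheses (R0 : 0 < R) (RtR : Rt < R) (b0 : 0 < b) (bR1 : n%:R * (b * R) <= 1).
Hypothesis bR2 : 2 * n%:R ^+ 2 * (b * R) <= (m.+1%:R / n%:R) ^+ n * (1 - Rt / R).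
Variables (Omega : set 'rV[K]_n) (u : 'rV[K]_n -> K) (g : 'rV[K]_n -> 'rV[K]_n).
Hypotheses (oOmega : open Omega) (OmegaRt : forall x, Omega x -> enorm x <= Rt).
Hypothesis ug : sobolev0 n Omega u g.

Let mO : measurable Omega. Proof. exact: open_measurable_rV. Qed.
Let measurable_u : measurable_fun Omega u. Proof. by case: ug. Qed.
Let G := (\int[mu]_(x in Omega) (enorm (g x) ^+ n)%:E)%E.

Lemma measurable_gradient_diff phi : test_function Omega phi ->
  measurable_fun Omega (fun x => enorm (gradient phi x - g x) ^+ n).
Proof.
move=> tphi; apply: measurable_funX; apply: measurable_enorm_coord => i.
have -> : (fun x => (gradient phi x - g x) ord0 i) =
    (fun x => gradient phi x ord0 i - g x ord0 i).
  by apply/funext => x; rewrite !mxE.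
apply: measurable_funB; first exact: measurable_gradient_coord.
exact: (measurable_sobolev_gradient ug).
Qed.

Lemma measurable_gradu_exp : measurable_fun Omega (fun x => enorm (g x) ^+ n).
Proof.
by apply: measurable_funX; apply: measurable_enorm_coord => i;
  exact: (measurable_sobolev_gradient ug).
Qed.

Lemma measurable_gradient_exp phi : test_function Omega phi ->
  measurable_fun Omega (fun x => enorm (gradient phi x) ^+ n).
Proof.
by move=> tphi; apply: measurable_funX; apply: measurable_enorm_coord => i;
  exact: measurable_gradient_coord.
Qed.

Lemma gradient_split phi s : 0 < s < 1 -> test_function Omega phi ->
  (\int[mu]_(x in Omega) (enorm (gradient phi x) ^+ n)%:E <=
   ((1 - s) ^- m.+1)%:E * G +
   (s ^- m.+1)%:E * \int[mu]_(x in Omega) (enorm (gradient phi x - g x) ^+ n)%:E)%E.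
Proof.
move=> /andP[s0 s1] tphi; apply: ge0_integral_comb => //.
- exact: measurable_gradu_exp.
- exact: measurable_gradient_diff.
- exact: measurable_gradient_exp.
- by rewrite invr_ge0 exprn_ge0// subr_ge0 ltW.
- by rewrite invr_ge0 exprn_ge0// ltW.
- by move=> x _; rewrite exprn_ge0// enorm_ge0.
- by move=> x _; rewrite exprn_ge0// enorm_ge0.
- by move=> x _; rewrite exprn_ge0// enorm_ge0.
move=> x _; apply: le_trans (convex_exprn m.+1 _ (enorm_ge0 _) (enorm_ge0 _)); last by rewrite s0.
rewrite lerXn2r// ?nnegrE ?addr_ge0 ?enorm_ge0//.
by rewrite -{1}[gradient phi x](subrK (g x)) addrC enorm_triangle.
Qed.

Lemma sobolev_gradient_fin : G \is a fin_num.
Proof.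
have [phi [tphi _ h]] := sobolev0_approx ug ltr01.
rewrite ge0_fin_numE; last by apply: integral_ge0 => x _; rewrite lee_fin exprn_ge0// enorm_ge0.
have s01 : 0 < (2^-1 : K) < 1 by lra.
have := @ge0_integral_comb K _ _ mu Omega (fun x => enorm (gradient phi x) ^+ n)
  (fun x => enorm (gradient phi x - g x) ^+ n) (fun x => enorm (g x) ^+ n)
  ((1 - 2^-1) ^- m.+1) (2^-1 ^- m.+1) mO.
have a0 : 0 <= (1 - 2^-1 : K) ^- m.+1 by rewrite invr_ge0 exprn_ge0//; lra.
have a1 : 0 <= (2^-1 : K) ^- m.+1 by rewrite invr_ge0 exprn_ge0.
move=> /(_ (measurable_gradient_exp tphi) (measurable_gradient_diff tphi) measurable_gradu_exp
  a0 a1) H.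
apply: le_lt_trans (H _ _ _ _) _.
- by move=> x _; rewrite exprn_ge0// enorm_ge0.
- by move=> x _; rewrite exprn_ge0// enorm_ge0.
- by move=> x _; rewrite exprn_ge0// enorm_ge0.
- move=> x _; apply: le_trans (convex_exprn m.+1 s01 (enorm_ge0 _) (enorm_ge0 _)).
  rewrite lerXn2r// ?nnegrE ?addr_ge0 ?enorm_ge0//.
  rewrite -(enormN (_ - _)) opprB -{1}[g x](subrK (gradient phi x)) addrC.
  exact: enorm_triangle.
apply: lte_add_pinfty; apply: lte_mul_pinfty => //.
- have cg : continuous (fun x => enorm (gradient phi x) ^+ n).
    move=> x; apply: (@continuous_pow K _ (fun x => enorm (gradient phi x)) n x).
    exact: (gradient_continuous tphi).
  have /integrableP[_] := Omega_continuous_integrable oOmega OmegaRt cg.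
  congr (_ < _)%E; apply: eq_integral => x _ /=.
  by rewrite ger0_norm// exprn_ge0// enorm_ge0.
- exact: le_lt_trans h (ltry _).
Qed.

Definition weight_bound (eps : K) : K :=
  (m.+1%:R / n%:R) ^+ n / (eps ^+ n * (1 - Rt / R) ^+ n) + hardy_gain m R b.

(** The cutoff makes the weight bounded, so that for fixed eps the weighted
    integral is continuous under L^N convergence. *)
Lemma cut_weight_le eps r : 0 < eps -> 0 <= r <= Rt ->
  cut_weight m R b eps r <= weight_bound eps.
Proof.
move=> e0 /andP[r0 rRt].
have k0 : 0 <= (m.+1%:R / n%:R : K) ^+ n by rewrite exprn_ge0// divr_ge0.
have t0 : 0 < 1 - Rt / R by rewrite subr_gt0 ltr_pdivrMr// mul1r.
have g0 : 0 <= hardy_gain m R b by rewrite ltW// hardy_gain_gt0.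
have [re|er] := leP r eps.
  rewrite /cut_weight /cutoff pospartE max_r ?subr_le0// expr0n/= !mul0r.
  by rewrite addr_ge0// divr_ge0// mulr_ge0// exprn_ge0// ltW.
have rp : 0 < r by exact: lt_trans er.
have /andP[chi0 chi1] := cutoff01 rp (ltW e0).
have rR : 0 <= r < R by rewrite r0 (le_lt_trans rRt).
apply: (@le_trans _ _ (hardy_potential m R r + hardy_gain m R b)).
  by rewrite ler_piMl// addr_ge0// hardy_potential_ge0.
have t1 : 0 < ln (R / r) by rewrite ln_ratio_gt0// rp; case/andP: rR.
rewrite lerD2r; apply: ler_wpM2l => //.
have p1 : 0 < r ^+ n * ln (R / r) ^+ n by apply: mulr_gt0; exact: exprn_gt0.
have p2 : 0 < eps ^+ n * (1 - Rt / R) ^+ n by apply: mulr_gt0; exact: exprn_gt0.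
rewrite lef_pV2//.
have t_ge : 1 - Rt / R <= ln (R / r).
  apply: le_trans (ln_ge_1BV _); last by rewrite divr_gt0.
  by rewrite invf_div lerD2l lerN2 ler_wpM2r// invr_ge0 ltW.
apply: ler_pM; rewrite ?exprn_ge0 ?(ltW e0) ?(ltW t0)//.
  by rewrite lerXn2r// ?nnegrE ?(ltW e0) ?(ltW er).
by rewrite lerXn2r// ?nnegrE ?(ltW t0)// (le_trans _ t_ge)// ltW.
Qed.

Let W eps (x : 'rV[K]_n) : K := cut_weight m R b eps (enorm x).

Let W0 eps x : Omega x -> 0 <= W eps x.
Proof.
move=> /OmegaRt xRt; apply: cut_weight_ge0 => //.
by rewrite enorm_ge0 (le_lt_trans xRt).
Qed.

Let mW eps : measurable_fun Omega (W eps).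
Proof. by apply: measurable_funTS; exact: measurable_cut_weight. Qed.

Let mWf eps (f : 'rV[K]_n -> K) : measurable_fun Omega f ->
  measurable_fun Omega (fun x => W eps x * `|f x| ^+ n).
Proof. by move=> mf; apply: measurable_funM => //; exact: measurable_norm_exp. Qed.

(** Both u and its gradient are compared with an approximating test function
    through the convexity of the N-th power. *)
Lemma hardy_cut eps : 0 < eps ->
  (\int[mu]_(x in Omega) (W eps x * `|u x| ^+ n)%:E <= G)%E.
Proof.
move=> e0; set X := (\int[_]_(_ in _) _)%E.
have Gf := sobolev_gradient_fin.
have X0 : (0 <= X)%E.
  by apply: integral_ge0 => x Ox; rewrite lee_fin mulr_ge0 ?W0// exprn_ge0.
pose B s := s ^- m.+1 + (1 - s) ^+ m.+1 * s ^- m.+1 * weight_bound eps.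
have step s e : 0 < s < 1 -> 0 < e ->
   (X <= ((1 - s) ^- m.+1 * ((1 - s) ^- m.+1 * fine G + B s * e))%:E)%E.
  move=> s01 e1; have /andP[s0 s1] := s01.
  have [phi [tphi h1 h2]] := sobolev0_approx ug e1.
  have cphi : measurable_fun Omega phi.
    by apply: measurable_funTS; apply: continuous_measurable_rV;
      exact: (test_function_continuous tphi).
  have p0 : 0 < (1 - s) ^- m.+1 by rewrite invr_gt0 exprn_gt0// subr_gt0.
  have p1 : 0 < s ^- m.+1 by rewrite invr_gt0 exprn_gt0.
  have wb0 : 0 <= weight_bound eps.
    apply: addr_ge0; last by rewrite ltW// hardy_gain_gt0.
    apply: divr_ge0; first by rewrite exprn_ge0// divr_ge0.
    apply: mulr_ge0; apply: exprn_ge0; first exact: ltW.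
    by rewrite subr_ge0 ler_pdivrMr// mul1r ltW.
  have hX : (X <= ((1 - s) ^- m.+1)%:E *
       \int[mu]_(x in Omega) (W eps x * `|phi x| ^+ n)%:E +
     (s ^- m.+1 * weight_bound eps)%:E *
       \int[mu]_(x in Omega) (`|phi x - u x| ^+ n)%:E)%E.
    apply: ge0_integral_comb.
    - exact: mO.
    - exact: mWf.
    - by apply: measurable_norm_exp; exact: measurable_funB.
    - exact: mWf.
    - exact: ltW p0.
    - by rewrite mulr_ge0// ltW.
    - by move=> x Ox; apply: mulr_ge0; [exact: W0|exact: exprn_ge0].
    - by move=> x Ox; exact: exprn_ge0.
    - by move=> x Ox; apply: mulr_ge0; [exact: W0|exact: exprn_ge0].
    move=> x Ox.
    have hc : `|u x| ^+ n <= (1 - s) ^- m.+1 * `|phi x| ^+ n +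
        s ^- m.+1 * `|phi x - u x| ^+ n.
      apply: le_trans (convex_exprn m.+1 s01 (normr_ge0 _) (normr_ge0 _)).
      rewrite lerXn2r// ?nnegrE ?addr_ge0//.
      by rewrite -{1}[u x](subKr (phi x)) ler_normB.
    apply: le_trans (ler_wpM2l (W0 _ Ox) hc) _.
    have hb : W eps x <= weight_bound eps by rewrite cut_weight_le// enorm_ge0 OmegaRt.
    rewrite mulrDr; apply: lerD; first by rewrite mulrCA.
    rewrite [leLHS]mulrCA -[leRHS]mulrA; apply: ler_wpM2l; first exact: ltW p1.
    by apply: ler_wpM2r hb; exact: exprn_ge0.
  have ht := hardy_test_function R0 RtR b0 bR1 bR2 oOmega OmegaRt e0 tphi.
  have hg := gradient_split s01 tphi.
  apply: le_trans hX _; apply: (@le_trans _ _ (((1 - s) ^- m.+1)%:E *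
     (((1 - s) ^- m.+1)%:E * G + (s ^- m.+1)%:E * e%:E) +
     (s ^- m.+1 * weight_bound eps)%:E * e%:E)%E).
    apply: leeD; apply: lee_wpmul2l; rewrite ?lee_fin ?(ltW p0) ?mulr_ge0 ?(ltW p1)//.
    apply: le_trans ht _; apply: le_trans hg _; apply: leeD2l.
    by apply: lee_wpmul2l; rewrite ?lee_fin ?(ltW p1).
  rewrite -{1}(fineK Gf) -!EFinM -!EFinD lee_fin le_eqVlt; apply/orP; left.
  apply/eqP; rewrite /B; field; rewrite !expf_neq0//; last by rewrite gt_eqF.
  by rewrite subr_eq0 gt_eqF.
have h2 : 0 < (2^-1 : K) < 1 by lra.
have Xf : X \is a fin_num.
  by rewrite ge0_fin_numE//; apply: le_lt_trans (step _ _ h2 ltr01) (ltry _).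
rewrite -(fineK Xf) -(fineK Gf) lee_fin.
apply: (@le_of_approx K (m.+1 + m.+1) _ _ (fun s => (1 - s) ^+ m.+1 * B s)).
  exact: fine_ge0.
move=> s e s01 e1; have := step s e s01 e1; rewrite -{1}(fineK Xf) lee_fin.
move/le_trans; apply; rewrite le_eqVlt; apply/orP; left; apply/eqP.
have /andP[s0 s1] := s01.
rewrite exprD; move: (B s) => Bs; field.
by rewrite expf_neq0// subr_eq0 gt_eqF.
Qed.


Let N0 : set 'rV[K]_n := [set x | `|x| <= 0].

Let mN0 : measurable N0. Proof. exact: measurable_box. Qed.

Let mu_N0 : mu N0 = 0%E.
Proof.
apply/eqP; rewrite eq_le measure_ge0 andbT.
have := @lebesgue_box_le K n N0 0 (lexx _) mN0.
rewrite mulr0 expr0n /=; apply => x xN i.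
exact: le_trans (coord_le_norm x i) xN.
Qed.

Lemma pospart_le (s t : K) : s <= t -> pospart s <= pospart t.
Proof.
move=> st; rewrite !pospartE ge_max le_max st /=.
by rewrite le_max lexx orbT.
Qed.

Lemma cutoff_le (e e' r : K) : 0 < r -> e' <= e -> cutoff e r <= cutoff e' r.
Proof.
move=> r0 ee'; rewrite /cutoff; apply: ler_wpM2r; first by rewrite invr_ge0 exprn_ge0// ltW.
have z0 (s : K) : 0 <= pospart s by rewrite pospartE le_max lexx orbT.
by rewrite lerXn2r ?nnegrE ?z0// pospart_le// lerD2l lerN2.
Qed.

Lemma cutoff_cvg (r : K) : 0 < r ->
  cutoff k.+1%:R^-1 r @[k --> \oo] --> (1 : K).
Proof.
move=> r0; have E1 : pospart (r - 0) ^+ 3 / r ^+ 3 = 1.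
  by rewrite subr0 pospartE max_l ?ltW// divff// expf_neq0// gt_eqF.
rewrite -[X in _ --> X]E1; apply: cvgM; last exact: cvg_cst.
have c : {for 0, continuous (fun e : K => pospart (r - e) ^+ 3)}.
  apply: continuous_pow; apply: (@continuous_comp_fun K K (fun e => r - e) (@pospart K)).
    by apply: continuous_add; [exact: continuous_cst|apply: continuous_opp; exact: cvg_id].
  exact: pospart_continuous.
exact: (cvg_comp _ _ (@cvg_harmonic K) c).
Qed.

(** The weights increase to the full potential as the cutoff parameter 1/(k+1)
    decreases to 0, except at the origin, which is a null set. *)
Lemma hardy_sobolev0 :
  (\int[mu]_(x in Omega)
     ((hardy_potential m R (enorm x) + hardy_gain m R b) * `|u x| ^+ n)%:E <= G)%E.
Proof.
pose F (x : 'rV[K]_n) : K := (hardy_potential m R (enorm x) + hardy_gain m R b) * `|u x| ^+ n.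
have mF : measurable_fun Omega F.
  apply: measurable_funM; last exact: measurable_norm_exp.
  by apply: measurable_funTS; apply: measurable_funD => //; exact: measurable_hardy_potential.
have F0 x : Omega x -> 0 <= F x.
  move=> /OmegaRt xRt; apply: mulr_ge0; last exact: exprn_ge0.
  apply: addr_ge0; last by rewrite ltW// hardy_gain_gt0.
  by rewrite hardy_potential_ge0// enorm_ge0 (le_lt_trans xRt).
rewrite (ge0_negligible_integral mN0 mO _ _ mu_N0)//; last first.
  exact/measurable_EFinP.
have mD : measurable (Omega `\` N0) by exact: measurableD.
pose Fk k (x : 'rV[K]_n) : \bar K := (W k.+1%:R^-1 x * `|u x| ^+ n)%:E.
have mFk k : measurable_fun (Omega `\` N0) (Fk k).
  apply/measurable_EFinP; apply: (measurable_funS mO); first exact: subDsetl.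
  exact: mWf.
have xpos x : (Omega `\` N0) x -> 0 < enorm x.
  move=> [_ /negP]; rewrite -ltNge => /lt_le_trans; apply; exact: norm_le_enorm.
have Fk0 k x : (Omega `\` N0) x -> (0 <= Fk k x)%E.
  by move=> [Ox _]; rewrite lee_fin; apply: mulr_ge0; [exact: W0|exact: exprn_ge0].
have Fkm x : (Omega `\` N0) x -> {homo Fk^~ x : k l / (k <= l)%N >-> (k <= l)%E}.
  move=> Dx k l kl; have [Ox _] := Dx; rewrite lee_fin; apply: ler_wpM2r; first exact: exprn_ge0.
  apply: ler_wpM2r.
    apply: addr_ge0; last by rewrite ltW// hardy_gain_gt0.
    by rewrite hardy_potential_ge0// enorm_ge0 (le_lt_trans (OmegaRt Ox)).
  by apply: cutoff_le; [exact: xpos|rewrite lef_pV2 ?posrE// ler_nat].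
have Fkc x : (Omega `\` N0) x -> Fk k x @[k --> \oo] --> (F x)%:E.
  move=> Dx; apply: cvg_EFin; first by near=> k.
  rewrite /comp /Fk /=; apply: cvgM; last exact: cvg_cst.
  rewrite -[X in _ --> X]mul1r; apply: cvgM; last exact: cvg_cst.
  exact/cutoff_cvg/xpos.
have := @cvg_monotone_convergence _ _ K mu _ mD Fk mFk Fk0 Fkm.
have -> : (\int[mu]_(x in Omega `\` N0) limn (Fk^~ x) = \int[mu]_(x in Omega `\` N0) (F x)%:E)%E.
  by apply: eq_integral => x; rewrite inE => Dx; apply/cvg_lim => //; exact: Fkc.
move=> c; rewrite -(cvg_lim _ c)//; apply: lime_le; first by apply/cvg_ex; eexists; exact: c.
near=> k; apply: le_trans (hardy_cut (eps := k.+1%:R^-1) _); last by rewrite invr_gt0.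
apply: ge0_subset_integral => //.
- by apply/measurable_EFinP; exact: mWf.
- by move=> x Ox; rewrite lee_fin; apply: mulr_ge0; [exact: W0|exact: exprn_ge0].
Unshelve. all: by end_near.
Qed.

End sobolev_hardy.

(** * From an L^N bound to the exponential distance *)

Section exponential_estimates.
Variable K : realType.
Implicit Types (v y z l : K).

(** Convexity of the exponential between 0 and v, from the tangent lines at
    l v. *)
Lemma expR_sub1_le_scale l v : 0 <= l <= 1 -> expR (l * v) - 1 <= l * (expR v - 1).
Proof.
move=> /andP[l0 l1].
have e0 : 0 <= expR (l * v) by exact: expR_ge0.
have h1 : expR (l * v) * (1 + (1 - l) * v) <= expR v.
  have -> : expR v = expR (l * v) * expR ((1 - l) * v).
    by rewrite -expRD; congr expR; ring.
  by rewrite ler_wpM2l// expR_ge1Dx.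
have h2 : expR (l * v) * (1 - l * v) <= 1.
  have E1 : expR (l * v) * expR (- (l * v)) = 1 by rewrite -expRD subrr expR0.
  by rewrite -[leRHS]E1 ler_wpM2l// expR_ge1Dx.
have := ler_wpM2l l0 h1; have := ler_wpM2l (_ : 0 <= 1 - l) h2.
by rewrite subr_ge0 => /(_ l1); lra.
Qed.

Lemma expR_sub1_le_mul v : expR v - 1 <= v * expR v.
Proof.
have : expR v * (1 - v) <= 1.
  have E1 : expR v * expR (- v) = 1 by rewrite -expRD subrr expR0.
  by rewrite -[leRHS]E1 ler_wpM2l ?expR_ge0// expR_ge1Dx.
by lra.
Qed.

Lemma expR_half_powR_le p y : 1 <= p -> 0 <= y ->
  expR (y `^ p / 2) - 1 <= y * expR (y `^ p / 2).
Proof.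
move=> p1 y0; have [y1|y1] := leP 1 y.
  apply: (@le_trans _ _ (expR (y `^ p / 2))); first by rewrite gerBl.
  by rewrite ler_peMl// expR_ge0.
apply: le_trans (expR_sub1_le_mul _) _; rewrite ler_wpM2r ?expR_ge0//.
have yp : y `^ p <= y.
  have [->|yn0] := eqVneq y 0; first by rewrite powR0// gt_eqF// (lt_le_trans ltr01).
  have yp : 0 < y by rewrite lt0r yn0.
  by rewrite -[leRHS]powRr1// ger_powR// yp ltW.
have := powR_ge0 y p; lra.
Qed.

(** A pointwise substitute for the Hoelder inequality with exponents N and
    N/(N-1), in which tau is to be taken of the order of the L^N norm of y.
    The exponential may be halved because N/(N-1) <= 2. *)
Lemma young_exp m y z (tau : K) : 0 < tau -> 0 <= y -> 0 <= z ->
  y * expR (z / 2) <= tau * (tau ^- m.+2 * y ^+ m.+2 + expR z).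
Proof.
move=> t0 y0 z0; pose c := expR (z / 2 / m.+1%:R).
have c0 : 0 <= c by exact: expR_ge0.
have cm : c ^+ m.+1 = expR (z / 2).
  by rewrite -expRM_natl; congr expR; rewrite mulrC divfK.
have cn : c ^+ m.+2 <= expR z.
  rewrite -expRM_natl ler_expR -mulrA mulrCA ler_piMr//.
  rewrite -invfM ler_pdivrMr ?mulr_gt0// mul1r.
  by rewrite -natrM ler_nat mul2n -addnn addSn !addnS !ltnS leq_addr.
have := @young_ineq K m.+1 (y / tau) c (divr_ge0 y0 (ltW t0)) c0.
rewrite cm expr_div_n => h.
have n0 : 0 < m.+2%:R :> K by [].
rewrite -(ler_pM2l n0); have := ler_wpM2l (ltW t0) h.
have -> : tau * (m.+2%:R * (y / tau) * expR (z / 2)) = m.+2%:R * (y * expR (z / 2)).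
  by field; rewrite gt_eqF.
move/le_trans; apply; rewrite [leRHS]mulrCA; apply: ler_wpM2l; first exact: ltW.
rewrite mulrDr.
apply: lerD.
  by rewrite mulrC ler_peMl ?ler1n// mulr_ge0 ?exprn_ge0// invr_ge0 exprn_ge0// ltW.
apply: ler_pM => //; first exact: exprn_ge0.
by rewrite ler_nat.
Qed.

End exponential_estimates.

Section orlicz.
Variables (K : realType) (m : nat).
Local Notation n := m.+2.
Local Notation mu := (lebesgue_rV K n).
Variables (Omega : set 'rV[K]_n) (u : 'rV[K]_n -> K).
Hypotheses (oOmega : open Omega) (measurable_u : measurable_fun Omega u).

Let mO : measurable Omega. Proof. exact: open_measurable_rV. Qed.

Lemma conj_exponentE : conj_exponent K n = n%:R / m.+1%:R.
Proof. by rewrite /conj_exponent -[n%:R]natr1 addrK. Qed.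

Lemma conj_exponent_ge1 : 1 <= conj_exponent K n.
Proof. by rewrite conj_exponentE ler_pdivlMr// mul1r ler_nat. Qed.

Lemma conj_exponent_le2 : conj_exponent K n <= 2.
Proof.
rewrite conj_exponentE ler_pdivrMr// -natrM ler_nat.
by rewrite mul2n -addnn addSn !addnS !ltnS leq_addr.
Qed.

Lemma luxemburg_ge0 : (0 <= luxemburg Omega u)%E.
Proof. by apply: le_ereal_inf_tmp => _ [l [l0 _] <-]; rewrite lee_fin ltW. Qed.

Lemma young_ge0 t : 0 <= young n t :> K.
Proof. by rewrite subr_ge0 -expR0 ler_expR powR_ge0. Qed.

Lemma measurable_powR_fun (f : 'rV[K]_n -> K) (p : K) : measurable_fun Omega f ->
  measurable_fun Omega (fun x => f x `^ p).
Proof. exact: (measurable_comp_fun (f := fun y : K => y `^ p)) (measurable_powR _). Qed.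

Lemma measurable_expR_fun (f : 'rV[K]_n -> K) : measurable_fun Omega f ->
  measurable_fun Omega (fun x => expR (f x)).
Proof. exact: (measurable_comp_fun (@measurable_expR K)). Qed.

Lemma distance_integrand_ge0 (C l0 R a : K) x : 0 <= C ->
  0 <= expR (C * `|u x - a * virtual_extremizer R x| `^ conj_exponent K n /
           l0 `^ conj_exponent K n) - 1.
Proof.
by move=> C0; rewrite subr_ge0 -expR0 ler_expR mulr_ge0 ?invr_ge0 ?powR_ge0// mulr_ge0 ?powR_ge0.
Qed.

Lemma extremizer_distance_ge0 R C : 0 <= C -> (0 <= extremizer_distance R C Omega u)%E.
Proof.
move=> C0; apply: le_ereal_inf_tmp => _ [a _ <-]; apply: integral_ge0 => x _.
by rewrite lee_fin; exact: distance_integrand_ge0.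
Qed.

(** The factor 2 between l and l0 costs at most 2^p <= 4 in the exponent, hence
    the condition on C; convexity then turns the small constant C into a
    prefactor. *)
Lemma distance_pointwise (C l0 l T y : K) : 0 <= C -> 8 * C <= 1 -> 0 < l0 -> l0 <= l ->
  l <= 2 * l0 -> 0 < T -> 0 <= y ->
  expR (C * y `^ conj_exponent K n / l0 `^ conj_exponent K n) - 1 <=
  8 * C * (T / l) * T ^- n * y ^+ n + 8 * C * (T / l) * (young n (y / l) + 1).
Proof.
move=> C0 C8 l00 l0l ll0 T0 y0; set p := conj_exponent K n.
have p1 : 1 <= p by exact: conj_exponent_ge1.
have p2 : p <= 2 by exact: conj_exponent_le2.
have lp : 0 < l by exact: lt_le_trans l0l.
have yl0 : 0 <= y / l by rewrite divr_ge0// ltW.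
set z := (y / l) `^ p; have z0 : 0 <= z by exact: powR_ge0.
have l0p : 0 < l0 `^ p by rewrite powR_gt0.
have ratio : (l / l0) `^ p <= 4.
  apply: (@le_trans _ _ (2 `^ p)).
    apply: (ge0_ler_powR (le_trans ler01 p1)); rewrite ?nnegrE//.
      by rewrite divr_ge0 ?(ltW lp) ?(ltW l00).
    by rewrite ler_pdivrMr.
  apply: (@le_trans _ _ (2 `^ 2)); first by rewrite ler_powR// ler1n.
  by rewrite powR_mulrn//; lra.
have yE : y `^ p / l0 `^ p = z * (l / l0) `^ p.
  have e1 : y `^ p = z * l `^ p.
    by rewrite /z -powRM ?(ltW lp)// divfK// gt_eqF.
  have e2 : l `^ p = (l / l0) `^ p * l0 `^ p.
    by rewrite -powRM ?(ltW l00) ?divr_ge0 ?(ltW lp) ?(ltW l00)// divfK// gt_eqF.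
  by rewrite e1 e2 mulrA mulfK// gt_eqF.
apply: (@le_trans _ _ (expR (8 * C * (z / 2)) - 1)).
  rewrite lerD2r ler_expR -mulrA yE.
  have -> : 8 * C * (z / 2) = C * (z * 4) by field.
  by rewrite ler_wpM2l// ler_wpM2l.
have C80 : 0 <= 8 * C by rewrite mulr_ge0.
apply: le_trans (expR_sub1_le_scale _ _) _; first by rewrite C80 C8.
have h := expR_half_powR_le p1 yl0.
have tau0 : 0 < T / l by rewrite divr_gt0.
have h2 := young_exp m tau0 yl0 z0.
have -> : 8 * C * (T / l) * T ^- n * y ^+ n + 8 * C * (T / l) * (young n (y / l) + 1) =
    8 * C * (T / l * (T ^- n * y ^+ n + (young n (y / l) + 1))) by ring.
apply: ler_wpM2l => //; apply: le_trans h _; apply: le_trans h2 _.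
rewrite /young -/z subrK !expr_div_n invfM invrK le_eqVlt; apply/orP; left.
apply/eqP; congr (_ * (_ + _)); move: (y ^+ n) (T ^+ n) (l ^+ n)
  (expf_neq0 n (lt0r_neq0 T0)) (expf_neq0 n (lt0r_neq0 lp)) => a c d c0 d0.
by field; rewrite c0 d0.
Qed.

(** The competitor a = 0 in the infimum bounds the distance by the L^N norm of u,
    because the exponential integrability encoded in the Luxemburg norm
    controls the remaining factor. The level l is an admissible one close to
    the infimum, which spares showing that the infimum is attained. *)
Lemma extremizer_distance_le R (C l0 l T V : K) : 0 <= C -> 8 * C <= 1 -> 0 < l0 ->
  l0 <= l -> l <= 2 * l0 -> 0 < T ->
  luxemburg Omega u = l0%:E ->
  (\int[mu]_(x in Omega) (young n (`|u x| / l))%:E <= 1)%E ->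
  (mu Omega <= V%:E)%E ->
  (\int[mu]_(x in Omega) (`|u x| ^+ n)%:E <= (T ^+ n)%:E)%E ->
  (extremizer_distance R C Omega u <= (8 * C * (T / l) * (2 + V))%:E)%E.
Proof.
move=> C0 C8 l00 l0l ll0 T0 lux hy hV hX.
have lp : 0 < l by exact: lt_le_trans l0l.
have mabs : measurable_fun Omega (fun x => `|u x|) by exact: measurableT_comp.
have myoung : measurable_fun Omega (fun x => young n (`|u x| / l)).
  apply: measurable_funB => //; apply: measurable_expR_fun; apply: measurable_powR_fun.
  exact: measurable_funM.
apply: ereal_inf_le; exists (\int[mu]_(x in Omega)
    (expR (C * `|u x - 0 * virtual_extremizer R x| `^ conj_exponent K n /
           fine (luxemburg Omega u) `^ conj_exponent K n) - 1)%:E)%E; first by exists 0.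
rewrite lux /=.
have c0 : 0 <= 8 * C * (T / l) by apply: mulr_ge0; [exact: mulr_ge0|rewrite ltW// divr_gt0].
have Tn : 0 < T ^+ n by exact: exprn_gt0.
have hc0 : 0 <= 8 * C * (T / l) * T ^- n by rewrite mulr_ge0// invr_ge0 ltW.
apply: (@le_trans _ _ ((8 * C * (T / l) * T ^- n)%:E * \int[mu]_(x in Omega) (`|u x| ^+ n)%:E +
   (8 * C * (T / l))%:E * \int[mu]_(x in Omega) (young n (`|u x| / l) + 1)%:E)%E).
  apply: ge0_integral_comb.
  - exact: mO.
  - exact: measurable_norm_exp.
  - exact: measurable_funD.
  - apply: measurable_funB => //; apply: measurable_expR_fun; apply: measurable_funM => //.
    apply: measurable_funM => //; apply: measurable_powR_fun.
    by under eq_fun do rewrite mul0r subr0.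
  - exact: hc0.
  - exact: c0.
  - by move=> x _; exact: exprn_ge0.
  - by move=> x _; rewrite addr_ge0// young_ge0.
  - by move=> x _; exact: distance_integrand_ge0.
  - move=> x _; rewrite mul0r subr0.
    exact: distance_pointwise.
have hyc : (\int[mu]_(x in Omega) (young n (`|u x| / l) + 1)%:E <= (1 + V)%:E)%E.
  under eq_integral do rewrite EFinD.
  rewrite ge0_integralD//.
  - by rewrite integral_cst// mul1e EFinD leeD.
  - by move=> x _; rewrite lee_fin young_ge0.
  - exact/measurable_EFinP.
apply: le_trans (leeD (lee_wpmul2l _ hX) (lee_wpmul2l _ hyc)) _; rewrite ?lee_fin//.
rewrite divfK ?gt_eqF// le_eqVlt; apply/orP; left.
by apply/eqP; ring.
Qed.

End orlicz.

(** * The stability inequality *)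

Unset Implicit Arguments.

(* When u = 0 a.e., luxemburg Omega u = 0 and the right-hand side is 0, as
   0 * y = 0 in \bar K for every y. *)
Theorem theorem1p1 (K : realType) (N : nat) (R Rt : K) :
  (2 <= N)%N -> Rt < R ->
  exists2 C : K, 0 < C &
    forall Omega : set 'rV[K]_N,
      open Omega -> bounded_set Omega -> Omega 0 ->
      Rt = sup [set enorm x | x in Omega] ->
      forall (u : 'rV[K]_N -> K) (gradu : 'rV[K]_N -> 'rV[K]_N),
        sobolev0 N Omega u gradu ->
        (luxemburg Omega u ^+ N * extremizer_distance R C Omega u ^+ N <=
         \int[lebesgue_rV K N]_(x in Omega) (enorm (gradu x) ^+ N)%:E -
         (((N%:R - 1) / N%:R) ^+ N)%:E *
         \int[lebesgue_rV K N]_(x in Omega)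
           (`|u x| ^+ N / (enorm x ^+ N * ln (R / enorm x) ^+ N))%:E)%E.
Proof.
case: N => [//|[//|m]] _ RtR.
have enormRt (Omega : set 'rV[K]_m.+2) : bounded_set Omega ->
    Rt = sup [set enorm x | x in Omega] -> forall x, Omega x -> enorm x <= Rt.
  move=> [B [_ OB]] -> x Ox; apply: ub_le_sup; last by exists x.
  exists (m.+2%:R * (B + 1)) => _ [y Oy <-]; apply: le_trans (enorm_le_norm y) _.
  by rewrite ler_wpM2l//; apply: OB => //; rewrite ltrDl.
have [R0|R0] := leP R 0.
  exists 1 => // Omega _ bO O0 RtE u gradu _.
  have := enormRt _ bO RtE _ O0; rewrite enorm0 => Rt0.
  by have := lt_le_trans RtR (le_trans R0 Rt0); rewrite ltxx.
pose n := m.+2.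
pose kappa : K := (m.+1%:R / n%:R) ^+ n.
have kappa0 : 0 < kappa by rewrite exprn_gt0// divr_gt0.
have t0 : 0 < 1 - Rt / R by rewrite subr_gt0 ltr_pdivrMr// mul1r.
(* The slope b of the perturbation of beta: the first bound keeps q <= 1, the
   second one makes the linear gain beat the quadratic loss. *)
pose b1 : K := Num.min n%:R^-1 (kappa * (1 - Rt / R) / (2 * n%:R ^+ 2)).
have n2 : 0 < 2 * n%:R ^+ 2 :> K by rewrite mulr_gt0// exprn_gt0// ltr0n.
have b10 : 0 < b1 by rewrite lt_min invr_gt0 ltr0n /= divr_gt0// mulr_gt0.
pose b := b1 / R.
have b0 : 0 < b by rewrite divr_gt0.
have bRE : b * R = b1 by rewrite divfK// gt_eqF.
have bR1 : n%:R * (b * R) <= 1.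
  by rewrite bRE mulrC -ler_pdivlMr ?ltr0n// mul1r ge_min lexx.
have bR2 : 2 * n%:R ^+ 2 * (b * R) <= kappa * (1 - Rt / R).
  by rewrite bRE mulrC -ler_pdivlMr// ge_min lexx orbT.
pose c := hardy_gain m R b.
have c0 : 0 < c by exact: hardy_gain_gt0.
(* V bounds the volume of Omega, contained in a cube of side 2 Rt. *)
pose V : K := (2 * Num.max Rt 0) ^+ n.
have V0 : 0 <= V by rewrite exprn_ge0// mulr_ge0// le_max lexx orbT.
have V2 : 0 < 16 * (2 + V) by rewrite mulr_gt0// ltr_wpDr.
pose C := Num.min 8^-1 (Num.min c 1 / (16 * (2 + V))).
have C0 : 0 < C by rewrite lt_min invr_gt0 ltr0n /= divr_gt0// lt_min c0 ltr01.
have C8 : 8 * C <= 1 by rewrite mulrC -ler_pdivlMr// mul1r ge_min lexx.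
have CV : (16 * C * (2 + V)) ^+ n <= c.
  have h : 16 * C * (2 + V) <= Num.min c 1.
    by rewrite mulrAC -ler_pdivlMl// mulrC ge_min lexx orbT.
  have h0 : 0 <= 16 * C * (2 + V) by rewrite !mulr_ge0 ?addr_ge0// ltW.
  have h1 : 16 * C * (2 + V) <= 1 by apply: le_trans h _; rewrite ge_min lexx orbT.
  have h2 : 16 * C * (2 + V) <= c by apply: le_trans h _; rewrite ge_min lexx.
  by apply: le_trans h2; rewrite exprS ler_piMr// exprn_ile1.
exists C => // Omega oO bO O0 RtE u gradu ug.
have OmegaRt := enormRt _ bO RtE.
have mO : measurable Omega by exact: open_measurable_rV.
have measurable_u : measurable_fun Omega u by case: ug.
have muO : (lebesgue_rV K n Omega <= V%:E)%E.
  apply: lebesgue_box_le => //; first by rewrite le_max lexx orbT.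
  move=> x /OmegaRt xR i; apply: le_trans (coord_le_enorm _ _) _.
  by rewrite le_max xR.
set G := (\int[_]_(_ in _) _)%E; set H := (\int[_]_(_ in _) _)%E.
have Gf : G \is a fin_num := sobolev_gradient_fin oO OmegaRt ug.
have -> : ((m.+2%:R - 1) / m.+2%:R : K) = m.+1%:R / n%:R.
  by rewrite -[m.+2%:R - 1](_ : m.+1%:R = _)// -[m.+2%:R in RHS]natr1 addrK.
rewrite -/n -/kappa.
pose X := (\int[lebesgue_rV K n]_(x in Omega) (`|u x| ^+ n)%:E)%E.
have X0 : (0 <= X)%E by apply: integral_ge0 => x _; rewrite lee_fin exprn_ge0.
have pot0 x : Omega x -> 0 <= hardy_potential m R (enorm x).
  by move=> Ox; rewrite hardy_potential_ge0// enorm_ge0 (le_lt_trans (OmegaRt _ Ox)).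
have mX : measurable_fun Omega (fun x => `|u x| ^+ n) by exact: measurable_norm_exp.
have main : (kappa%:E * H + c%:E * X <= G)%E.
  apply: le_trans (hardy_sobolev0 R0 RtR b0 bR1 bR2 oO OmegaRt ug).
  have mpot : measurable_fun Omega (fun x => hardy_potential m R (enorm x)).
    by apply: measurable_funTS; exact: measurable_hardy_potential.
  under [leRHS]eq_integral do rewrite mulrDl EFinD.
  rewrite ge0_integralD//.
  - apply: leeD.
      rewrite -ge0_integralZl_EFin//.
      + rewrite le_eqVlt; apply/orP; left; apply/eqP; apply: eq_integral => x _.
        by rewrite -EFinM /hardy_potential mulrA; congr EFin; rewrite mulrAC.
      + move=> x Ox; rewrite lee_fin.
        have := mulr_ge0 (pot0 x Ox) (exprn_ge0 n (normr_ge0 (u x))).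
        rewrite /hardy_potential -mulrA pmulr_rge0// mulrC//.
      + apply/measurable_EFinP.
        have -> : (fun x => `|u x| ^+ m.+2 / (enorm x ^+ m.+2 * ln (R / enorm x) ^+ m.+2)) =
          (fun x => `|u x| ^+ n * (kappa^-1 * hardy_potential m R (enorm x))).
          by apply/funext => x; rewrite /hardy_potential mulKf// gt_eqF.
        by apply: measurable_funM => //; exact: measurable_funM.
      + exact: ltW.
    have mXe : measurable_fun Omega (fun x => (`|u x| ^+ n)%:E) by exact/measurable_EFinP.
    by rewrite -(ge0_integralZl_EFin _ _ _ mXe (ltW c0)).
  - by move=> x Ox; rewrite lee_fin mulr_ge0 ?pot0// exprn_ge0.
  - by apply/measurable_EFinP; exact: measurable_funM.
  - by move=> x Ox; rewrite lee_fin mulr_ge0 ?exprn_ge0// ltW.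
  - by apply/measurable_EFinP; exact: measurable_funM.
have H0 : (0 <= H)%E.
  apply: integral_ge0 => x Ox; rewrite lee_fin.
  have := mulr_ge0 (pot0 x Ox) (exprn_ge0 n (normr_ge0 (u x))).
  by rewrite /hardy_potential -mulrA pmulr_rge0// mulrC.
have kH0 : (0 <= kappa%:E * H)%E by rewrite mule_ge0// lee_fin ltW.
have cX0 : (0 <= c%:E * X)%E by rewrite mule_ge0// lee_fin ltW.
have sum_lty : (kappa%:E * H + c%:E * X < +oo)%E.
  by apply: le_lt_trans main _; rewrite ltey_eq Gf.
have kHf : (kappa%:E * H)%E \is a fin_num.
  by rewrite ge0_fin_numE//; apply: le_lt_trans sum_lty; rewrite leeDl.
have cXf : (c%:E * X)%E \is a fin_num.
  by rewrite ge0_fin_numE//; apply: le_lt_trans sum_lty; rewrite leeDr.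
apply: (@le_trans _ _ (c%:E * X)%E); last by rewrite leeBrDr// addeC.
have D0 : (0 <= extremizer_distance R C Omega u)%E.
  by apply: extremizer_distance_ge0; exact: ltW.
have := luxemburg_ge0 Omega u.
case lux : (luxemburg Omega u) => [l0| |]; last by [].
- rewrite lee_fin le_eqVlt => /orP[/eqP <-|l00].
    by rewrite -EFin_expe expr0n /= mul0e.
  have Xf : X \is a fin_num.
    rewrite ge0_fin_numE//; move: cXf; case: (X) X0 => [x| |]//; rewrite ?ltry//.
    by move=> _; rewrite gt0_muley.
  have : (luxemburg Omega u < (2 * l0)%:E)%E by rewrite lux lte_fin; lra.
  move=> /ereal_inf_lt[_ [l [lp hy] <-]]; rewrite lte_fin => ll0.
  have l0l : l0 <= l by rewrite -lee_fin -lux; apply: ereal_inf_lbound; exists l.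
  (* T ranges over the upper bounds of the L^N norm of u. *)
  have DT (T : K) : 0 < T -> fine X <= T ^+ n ->
      (extremizer_distance R C Omega u <= (8 * C * (T / l) * (2 + V))%:E)%E.
    move=> T0 XT; apply: (@extremizer_distance_le K m Omega u oO measurable_u R C l0 l T V) => //.
    - exact: ltW.
    - exact: ltW.
    - by rewrite -/X -(fineK Xf) lee_fin.
  have Df : extremizer_distance R C Omega u \is a fin_num.
    rewrite ge0_fin_numE//; apply: le_lt_trans (DT (fine X + 1) _ _) (ltry _).
      by rewrite ltr_wpDl// fine_ge0.
    have h1 : 1 <= fine X + 1 by rewrite lerDr fine_ge0.
    by rewrite exprS; apply: (@le_trans _ _ (fine X + 1));
      rewrite ?lerDl// ler_peMr ?(le_trans _ h1)// exprn_ege1.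
  rewrite -(fineK Df) -(fineK Xf) -!EFin_expe -!EFinM lee_fin -exprMn.
  set w := l0 * _; have w0 : 0 <= w by rewrite mulr_ge0 ?fine_ge0// ltW.
  rewrite leNgt; apply/negP => hw.
  have wp : 0 < w.
    rewrite lt0r w0 andbT; apply/eqP => wE; move: hw.
    by rewrite wE expr0n /= ltNge mulr_ge0 ?fine_ge0// ltW.
  have q0 : 0 < 16 * C * (2 + V) by rewrite !mulr_gt0// ltr_wpDr.
  (* If the claim failed, this T would be admissible and would bound w by w / 2. *)
  have := DT (w / (16 * C * (2 + V))) (divr_gt0 wp q0).
  rewrite expr_div_n ler_pdivlMr ?exprn_gt0// => DT'.
  have /DT' : fine X * (16 * C * (2 + V)) ^+ n <= w ^+ n.
    apply: le_trans (ltW hw); rewrite mulrC; apply: ler_wpM2r CV.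
    exact: fine_ge0.
  rewrite -{1}(fineK Df) lee_fin => hD.
  have lp0 : 0 < l by [].
  have : w <= w / 2.
    apply: (@le_trans _ _ (l * fine (extremizer_distance R C Omega u))).
      by apply: ler_wpM2r; rewrite ?fine_ge0.
    apply: le_trans (ler_wpM2l (ltW lp0) hD) _; rewrite le_eqVlt; apply/orP; left.
    apply/eqP; field; rewrite !gt_eqF// ltr_wpDr//.
  by rewrite leNgt ltr_pdivrMr// ltr_pMr// ltr1n.
(* Here the Luxemburg norm is infinite, so its real part is 0 and the
   integrand of the distance vanishes identically. *)
- move=> _; suff -> : extremizer_distance R C Omega u = 0%E.
    by rewrite -EFin_expe expr0n /= mule0.
  apply/eqP; rewrite eq_le D0 andbT; apply: ereal_inf_le.
  exists 0%E => //; exists 0 => //; rewrite lux /=; apply: integral0_eq => x _.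
  rewrite powR0 ?invr0 ?mulr0 ?expR0 ?subrr//.
  by rewrite gt_eqF// (lt_le_trans ltr01)// conj_exponent_ge1.
Qed.
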